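(* Let $R$ be a local ring of Krull dimension one with regular maximal ideal $M$, let $m\in M$ be a nonzerodivisor, and let $\widetilde{R}$ be the $mR$-adic completion of $R$. The following are equivalent: (1) $M^n$ can be generated by two elements for some $n\ge2$. (2) $\widetilde{R}$ is a Noetherian local ring of multiplicity at most $2$. (3) Every regular ideal of $R$ can be generated by two elements.
   Context: All rings are commutative with identity; a local ring is a ring with a unique maximal ideal (not necessarily Noetherian). An ideal is regular if it contains a nonzerodivisor. The multiplicity of a Noetherian local ring $(A,\mathfrak n)$ of dimension $d$ is $d!$ times the leading coefficient of the polynomial that agrees with the length of $A/\mathfrak n^k$ for large $k$. ($\widetilde R$ does not depend on the choice of $m$.) *)

(* Defs.v *)
From HB Require Import structures.
From mathcomp Require Import all_boot all_order all_algebra.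
Set Implicit Arguments. Unset Strict Implicit. Unset Printing Implicit Defensive.
Import GRing.Theory.
Local Open Scope ring_scope.

(* A commutative ring presented as a setoid: carrier, an equivalence relation
   playing the role of equality, and the ring operations.  This lets us treat
   both R (with Leibniz equality) and its mR-adic completion (an inverse limit,
   i.e. compatible sequences modulo equivalence) uniformly. *)
Record sring := SRing {
  car :> Type;
  seqv : car -> car -> Prop;
  s0 : car; s1 : car;
  sadd : car -> car -> car;
  sopp : car -> car;
  smul : car -> car -> car }.

Section Generic.
Variable A : sring.
Local Notation "x ~ y" := (seqv x y) (at level 70).

Fixpoint ssum (f : nat -> A) (n : nat) : A :=
  match n with 0 => s0 A | S n => sadd (ssum f n) (f n) end.

Definition is_ideal (I : A -> Prop) : Prop :=
  [/\ (forall x y, x ~ y -> I x -> I y), I (s0 A),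
      (forall x y, I x -> I y -> I (sadd x y)) &
      (forall r x, I x -> I (smul r x))].

Definition same_set (I J : A -> Prop) : Prop := forall x, I x <-> J x.
Definition sub_set (I J : A -> Prop) : Prop := forall x, I x -> J x.
Definition ssub_set (I J : A -> Prop) : Prop := sub_set I J /\ ~ sub_set J I.

Definition proper (I : A -> Prop) : Prop := ~ I (s1 A).

Definition maximal_ideal (M : A -> Prop) : Prop :=
  [/\ is_ideal M, proper M &
      forall J, is_ideal J -> proper J -> sub_set M J -> sub_set J M].

Definition is_local (M : A -> Prop) : Prop :=
  maximal_ideal M /\ forall N, maximal_ideal N -> same_set N M.

Definition prime_ideal (P : A -> Prop) : Prop :=
  [/\ is_ideal P, proper P &
      forall x y, P (smul x y) -> P x \/ P y].

Definition krull_dim_ge (n : nat) : Prop :=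
  exists P : nat -> A -> Prop,
    (forall i, (i <= n)%N -> prime_ideal (P i)) /\
    (forall i, (i < n)%N -> ssub_set (P i) (P i.+1)).

Definition krull_dim (d : nat) : Prop := krull_dim_ge d /\ ~ krull_dim_ge d.+1.

Definition nonzerodivisor (x : A) : Prop :=
  forall y, smul x y ~ s0 A -> y ~ s0 A.

Definition regular_ideal (I : A -> Prop) : Prop :=
  exists x, I x /\ nonzerodivisor x.

Definition span (S : A -> Prop) : A -> Prop := fun x =>
  exists (n : nat) (r a : nat -> A),
    (forall i, (i < n)%N -> S (a i)) /\ x ~ ssum (fun i => smul (r i) (a i)) n.

Fixpoint ipow (I : A -> Prop) (n : nat) : A -> Prop :=
  match n with
  | 0 => fun _ => True
  | S n => span (fun x => exists a b, ipow I n a /\ I b /\ x ~ smul a b)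
  end.

Definition two_generated (I : A -> Prop) : Prop :=
  exists a b, same_set I (span (fun y => y ~ a \/ y ~ b)).

Definition finitely_generated (I : A -> Prop) : Prop :=
  exists (n : nat) (a : nat -> A),
    same_set I (span (fun y => exists i, (i < n)%N /\ y ~ a i)).

Definition noetherian : Prop :=
  forall I, is_ideal I -> finitely_generated I.

(* length of the A-module A/J : submodules of A/J correspond to ideals
   containing J, so the length is the maximal length of a strict chain of
   ideals containing J. *)
Definition chain_ge (J : A -> Prop) (l : nat) : Prop :=
  exists I : nat -> A -> Prop,
    (forall i, (i <= l)%N -> is_ideal (I i) /\ sub_set J (I i)) /\
    (forall i, (i < l)%N -> ssub_set (I i) (I i.+1)).

Definition quot_length (J : A -> Prop) (l : nat) : Prop :=
  chain_ge J l /\ ~ chain_ge J l.+1.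

Definition multiplicity (e : rat) : Prop :=
  exists (N : A -> Prop) (d : nat) (P : {poly rat}),
    [/\ is_local N, krull_dim d,
        (exists k0, forall k, (k0 <= k)%N ->
            exists l, quot_length (ipow N k) l /\ P.[k%:R] = l%:R) &
        e = (d`!)%:R * lead_coef P].

Definition noetherian_local_mult_le2 : Prop :=
  noetherian /\ (exists N, is_local N) /\
  exists e, multiplicity e /\ e <= 2.

End Generic.

Definition ring_sring (R : comNzRingType) : sring :=
  @SRing R (@eq R) 0 1 +%R -%R *%R.

(* The mR-adic completion of R: the inverse limit of R/m^k R
   (note (mR)^k = m^k R), realised as compatible sequences f with
   f (k+1) = f k mod m^k R, modulo f ~ g iff f k = g k mod m^k R for all k. *)
Section Completion.
Variables (R : comNzRingType) (m : R).

Definition inmk (k : nat) (x : R) : Prop := exists r, x = m ^+ k * r.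

Definition compat (f : nat -> R) : Prop := forall k, inmk k (f k.+1 - f k).

Definition cseq := {f : nat -> R | compat f}.

Lemma compat_const (c : R) : compat (fun _ => c).
Proof. by move=> k; exists 0; rewrite subrr mulr0. Qed.

Lemma compat_add (f g : nat -> R) :
  compat f -> compat g -> compat (fun k => f k + g k).
Proof.
move=> hf hg k; have [r hr] := hf k; have [s hs] := hg k.
exists (r + s); rewrite mulrDr -hr -hs opprD !addrA; congr (_ + _).
by rewrite -!addrA; congr (_ + _); rewrite addrC.
Qed.

Lemma compat_opp (f : nat -> R) : compat f -> compat (fun k => - f k).
Proof.
move=> hf k; have [r hr] := hf k; exists (- r).
by rewrite mulrN -hr opprB opprK addrC.
Qed.

Lemma compat_mul (f g : nat -> R) :
  compat f -> compat g -> compat (fun k => f k * g k).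
Proof.
move=> hf hg k; have [r hr] := hf k; have [s hs] := hg k.
exists (f k.+1 * s + r * g k).
rewrite mulrDr mulrCA -hs mulrA -hr.
rewrite mulrBr mulrBl addrA; congr (_ + _).
by rewrite -addrA addNr addr0.
Qed.

Definition cadd (f g : cseq) : cseq :=
  exist _ _ (compat_add (proj2_sig f) (proj2_sig g)).
Definition copp (f : cseq) : cseq := exist _ _ (compat_opp (proj2_sig f)).
Definition cmul (f g : cseq) : cseq :=
  exist _ _ (compat_mul (proj2_sig f) (proj2_sig g)).
Definition cconst (c : R) : cseq := exist _ _ (compat_const c).
Definition ceqv (f g : cseq) : Prop :=
  forall k, inmk k (proj1_sig f k - proj1_sig g k).

Definition completion : sring :=
  @SRing cseq ceqv (cconst 0) (cconst 1) cadd copp cmul.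

End Completion.

(* Main.v *)
Require Import Defs.
From mathcomp Require Import all_boot all_order all_algebra.
From HB Require Import structures.
From mathcomp Require Import generic_quotient boolp classical_sets ring lra.
Set Implicit Arguments. Unset Strict Implicit. Unset Printing Implicit Defensive.

(* Over any residue field, if M^n = (a, b) with n >= 2 then M^n = y M^(n-1) for
   some nonzerodivisor y in M; cancelling y, M^(n-1) is again generated by two
   elements.  Descending to n = 2 gives M = (y, x) and M^2 = y M.  This structure
   passes to the completion C.

   Let I be an ideal.  Dividing by powers of y, we may assume that I contains
   some w outside yR.  If I = R there is nothing to prove; otherwise M = (y, w),
   the maximal ideal of R/wR is generated by y, and a regular I is (w, y^j) for
   the least j with y^j in I.  In C an ideal containing no power of y is
   principal up to a power of y, by completeness; hence C is Noetherian of
   dimension at most 1, and the length of C/N^k is 1 + e(k - 1), where e <= 2 is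
   the dimension of N/yN.

   Conversely, C/N^k has length at most linear in k.  If no N^n with n >= 2 were
   generated by two elements modulo N^(n+1), this length would be at least
   3(k - 2), so the leading coefficient would be at least 3.  Thus some N^n is
   generated by two elements modulo N^(n+1); these lift to R, where Nakayama
   applies. *)

(** Over an infinite residue field a generic element of N would serve as the multiplier y; over a
    finite one there may be no such element, so y is found by cases on a few explicit elements. The
    definition of multiplicity does not tie the degree of the length polynomial to the dimension: it
    bounds only the leading coefficient. A linear upper bound on the lengths is therefore proved
    separately, from the nilpotency of N modulo m, in order to exclude degree two or more before
    slopes are compared. The constant 3 counts the strict steps available in N^n/N^(n+1) when two
    elements never generate it, and the shift by 2 reflects that only powers n >= 2 are known to
    behave so. As R is not assumed Noetherian, Nakayama can be used in R for the descent only after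
    finite generation of M^n has been pulled back from C. The completion comes as a setoid; it is
    replaced by an isomorphic quotient ring, of which only density, separation, completeness and the
    comparison of the two m-adic filtrations are used. *)

Local Notation idl S := (@is_ideal (ring_sring S)).
Local Notation "I ^^ n" := (@ipow (ring_sring _) I n) (at level 30).

(** * Ideals *)

Section Ideals.
Variable S : comNzRingType.
Import GRing.Theory.
Local Open Scope ring_scope.
Implicit Types (I J K X Y : S -> Prop) (x y z a b r s t : S).

Definition adjoin X a : S -> Prop := fun z => exists x r, X x /\ z = x + r * a.
Definition scale c X : S -> Prop := fun z => exists x, X x /\ z = c * x.
Definition span2 a b : S -> Prop := fun z => exists r s, z = r * a + s * b.
Definition principal c : S -> Prop := fun z => exists r, z = c * r.
Definition isum I J : S -> Prop := fun z => exists x y, [/\ I x, J y & z = x + y].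

Lemma idealP I : I 0 -> (forall x y, I x -> I y -> I (x + y)) ->
  (forall r x, I x -> I (r * x)) -> idl S I.
Proof. by move=> I0 ID IM; split=> //= x y ->. Qed.

Section IdealClosure.
Variables (I : S -> Prop) (hI : idl S I).
Lemma idl0 : I 0. Proof. by case: hI. Qed.
Lemma idlD x y : I x -> I y -> I (x + y). Proof. by case: hI => _ _ h _; apply: h. Qed.
Lemma idlMl r x : I x -> I (r * x). Proof. by case: hI => _ _ _ h; apply: h. Qed.
Lemma idlMr r x : I x -> I (x * r). Proof. by rewrite mulrC; apply: idlMl. Qed.
Lemma idlN x : I x -> I (- x). Proof. by rewrite -mulN1r; apply: idlMl. Qed.
Lemma idlB x y : I x -> I y -> I (x - y).
Proof. by move=> hx hy; apply: idlD => //; apply: idlN. Qed.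
Lemma ideal_unit u v x : u * v = 1 -> I (u * x) -> I x.
Proof. by move=> uv /(idlMl v); rewrite mulrA (mulrC v) uv mul1r. Qed.
Lemma ideal_ssum f n : (forall i, (i < n)%N -> I (f i)) -> I (@ssum (ring_sring S) f n).
Proof.
elim: n => [|n IH] h /=; first exact: idl0.
by apply: idlD; [apply: IH => i ?; apply: h; apply: ltnW | apply: h].
Qed.
End IdealClosure.

Lemma ideal_True : idl S (fun=> True). Proof. exact: idealP. Qed.

Lemma ideal_zero : idl S (eq 0).
Proof.
by apply: idealP => [|x y <- <-|r x <-] //; rewrite ?addr0 ?mulr0.
Qed.

Lemma ideal_principal c : idl S (principal c).
Proof.
apply: idealP => [|x y [r ->] [s ->]|t x [r ->]]; first by exists 0; rewrite mulr0.
- by exists (r + s); rewrite mulrDr.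
- by exists (t * r); rewrite mulrCA.
Qed.

Lemma ideal_adjoin X a : idl S X -> idl S (adjoin X a).
Proof.
move=> hX; apply: idealP.
- by exists 0, 0; split; [exact: idl0 | ring].
- move=> _ _ [x [r [hx ->]]] [y [s [hy ->]]]; exists (x + y), (r + s).
  by split; [exact: idlD | ring].
- move=> t _ [x [r [hx ->]]]; exists (t * x), (t * r).
  by split; [exact: idlMl | ring].
Qed.

Lemma ideal_scale c X : idl S X -> idl S (scale c X).
Proof.
move=> hX; apply: idealP.
- by exists 0; split; [exact: idl0 | ring].
- move=> _ _ [x [hx ->]] [y [hy ->]]; exists (x + y).
  by split; [exact: idlD | ring].
- by move=> t _ [x [hx ->]]; exists (t * x); split; [exact: idlMl | ring].
Qed.

Lemma ideal_isum I J : idl S I -> idl S J -> idl S (isum I J).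
Proof.
move=> hI hJ; apply: idealP.
- by exists 0, 0; split; [exact: idl0| exact: idl0 | ring].
- move=> _ _ [x [y [? ? ->]]] [x' [y' [? ? ->]]]; exists (x + x'), (y + y').
  by split; [exact: idlD | exact: idlD | ring].
- move=> t _ [x [y [? ? ->]]]; exists (t * x), (t * y).
  by split; [exact: idlMl | exact: idlMl | ring].
Qed.

Lemma ideal_colon c X : idl S X -> idl S (fun z => X (c * z)).
Proof.
move=> hX; apply: idealP => [|x y hx hy|r x hx].
- by rewrite mulr0; exact: idl0.
- by rewrite mulrDr; exact: idlD.
- by rewrite mulrCA; exact: idlMl.
Qed.

Lemma ideal_span2 a b : idl S (span2 a b).
Proof.
apply: idealP => [|x y [r [s ->]] [r' [s' ->]]|t x [r [s ->]]].
- by exists 0, 0; ring.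
- by exists (r + r'), (s + s'); ring.
- by exists (t * r), (t * s); ring.
Qed.

Lemma sub_adjoin X a x : X x -> adjoin X a x.
Proof. by move=> hx; exists x, 0; split=> //; ring. Qed.

Lemma mem_adjoin X a : idl S X -> adjoin X a a.
Proof. by move=> hX; exists 0, 1; split; [exact: idl0 | ring]. Qed.

Lemma adjoin_min X a K : idl S K -> (forall x, X x -> K x) -> K a ->
  forall z, adjoin X a z -> K z.
Proof. by move=> hK XK Ka _ [x [r [/XK Kx ->]]]; apply: idlD => //; apply: idlMl. Qed.

Lemma span2_min a b K : idl S K -> K a -> K b -> forall z, span2 a b z -> K z.
Proof. by move=> hK Ka Kb _ [r [s ->]]; apply: idlD => //; apply: idlMl. Qed.

Lemma span2l a b : span2 a b a. Proof. by exists 1, 0; ring. Qed.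
Lemma span2r a b : span2 a b b. Proof. by exists 0, 1; ring. Qed.

Lemma span_min (G : S -> Prop) I : idl S I -> (forall x, G x -> I x) ->
  forall z, @Defs.span (ring_sring S) G z -> I z.
Proof.
move=> hI GI z [n [r [a [Ga /= ->]]]]; apply: ideal_ssum => // i /Ga /GI.
exact: idlMl.
Qed.

Lemma mem_span (G : S -> Prop) x : G x -> @Defs.span (ring_sring S) G x.
Proof.
by move=> Gx; exists 1%N, (fun=> 1), (fun=> x); split=> //=; rewrite add0r mul1r.
Qed.

Lemma ssum_cat (f g : nat -> S) n k :
  @ssum (ring_sring S) (fun i => if (i < n)%N then f i else g (i - n)%N) (n + k)%N
  = @ssum (ring_sring S) f n + @ssum (ring_sring S) g k.
Proof.
elim: k => [|k IH].
  rewrite addn0 /= addr0.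
  have : forall j, (j <= n)%N ->
    @ssum (ring_sring S) (fun i => if (i < n)%N then f i else g (i - n)%N) j
    = @ssum (ring_sring S) f j.
    by elim=> [|j IHj] //= jn; rewrite IHj ?jn //; exact: ltnW.
  by move=> -> //.
by rewrite addnS /= IH ltnNge leq_addr /= addKn addrA.
Qed.

Lemma ssum_scale t (f : nat -> S) n :
  t * @ssum (ring_sring S) f n = @ssum (ring_sring S) (fun i => t * f i) n.
Proof. by elim: n => [|n /= <-]; rewrite /= ?mulr0 ?mulrDr. Qed.

Lemma eq_ssum (f g : nat -> S) n : (forall i, f i = g i) ->
  @ssum (ring_sring S) f n = @ssum (ring_sring S) g n.
Proof. by move=> h; elim: n => [|n /= ->] //; rewrite h. Qed.

Lemma ideal_span (G : S -> Prop) : idl S (@Defs.span (ring_sring S) G).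
Proof.
apply: idealP.
- by exists 0%N, (fun=> 0), (fun=> 0).
- move=> x y [n [r [a [Ga /= ->]]]] [k [s [b [Gb /= ->]]]].
  exists (n + k)%N, (fun i => if (i < n)%N then r i else s (i - n)%N),
    (fun i => if (i < n)%N then a i else b (i - n)%N); split => [i|/=].
    case: ifP => [/Ga //|/negbT]; rewrite -leqNgt => ni ink; apply: Gb.
    by rewrite ltn_subLR.
  rewrite -ssum_cat; apply: eq_ssum => i; by case: ifP.
- move=> t x [n [r [a [Ga /= ->]]]]; exists n, (fun i => t * r i), a; split=> //=.
  by rewrite ssum_scale; apply: eq_ssum => i; rewrite mulrA.
Qed.

Lemma span2E a b z : @Defs.span (ring_sring S) (fun y => y = a \/ y = b) z <-> span2 a b z.
Proof.
split.
  by apply: span_min z; [exact: ideal_span2 | move=> x [] ->; [exact: span2l | exact: span2r]].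
by apply: span2_min z; [exact: ideal_span | apply: mem_span; left | apply: mem_span; right].
Qed.

Lemma two_generatedP I : @two_generated (ring_sring S) I <->
  exists a b, forall z, I z <-> span2 a b z.
Proof. by split=> -[a [b h]]; exists a, b => z; move: (h z); rewrite span2E. Qed.

(** Generators are adjoined to [X] one at a time, so that Nakayama and the length estimates can
    remove them by induction on [n]. *)
Fixpoint gens X (a : nat -> S) n : S -> Prop :=
  if n is n'.+1 then adjoin (gens X a n') (a n') else X.

Lemma ideal_gens X g n : idl S X -> idl S (gens X g n).
Proof. by move=> hX; elim: n => //= n IH; apply: ideal_adjoin. Qed.

Lemma sub_gens X g n x : X x -> gens X g n x.
Proof. by move=> hx; elim: n => //= n IH; apply: sub_adjoin. Qed.

Lemma mem_gens X g n i : idl S X -> (i < n)%N -> gens X g n (g i).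
Proof.
move=> hX; elim: n => //= n IH; rewrite ltnS leq_eqVlt => /orP[/eqP->|/IH].
  by apply: mem_adjoin; apply: ideal_gens.
exact: sub_adjoin.
Qed.

Lemma gens_min X g n K : idl S K -> (forall x, X x -> K x) ->
  (forall i, (i < n)%N -> K (g i)) -> forall z, gens X g n z -> K z.
Proof.
move=> hK XK; elim: n => //= n IH aK; apply: adjoin_min => //; last exact: aK.
by apply: IH => i hi; apply: aK; apply: ltnW.
Qed.

Lemma spanE (a : nat -> S) n z :
  @Defs.span (ring_sring S) (fun y => exists i, (i < n)%N /\ y = a i) z <-> gens (eq 0) a n z.
Proof.
split.
  apply: span_min z; first by apply: ideal_gens; exact: ideal_zero.
  by move=> x [i [hi ->]]; apply: mem_gens => //; exact: ideal_zero.
apply: gens_min z; first exact: ideal_span.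
- by move=> x <-; apply: idl0; exact: ideal_span.
- by move=> i hi; apply: mem_span; exists i.
Qed.

Lemma fgP I : @finitely_generated (ring_sring S) I <->
  exists n g, forall z, I z <-> gens (eq 0) g n z.
Proof.
by split=> -[n [a h]]; exists n, a => z; move: (h z); rewrite /= spanE.
Qed.

Lemma two_generated_fg I : @two_generated (ring_sring S) I -> @finitely_generated (ring_sring S) I.
Proof.
move=> /two_generatedP[a [b h]]; apply/fgP.
exists 2%N, (fun i => if i == 0%N then a else b) => z; rewrite h /=; split.
- move=> [r [s ->]]; exists (r * a), s; split=> //; exists 0, r; split=> //; ring.
- by move=> [x [s [[y [r [<- ->]]] ->]]]; exists r, s; ring.
Qed.

Section Powers.
Variables (I : S -> Prop) (hI : idl S I).

Lemma ideal_ipow n : idl S (I ^^ n).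
Proof. by case: n => [|n]; [exact: ideal_True | exact: ideal_span]. Qed.

Lemma ipowSM n a b : (I ^^ n) a -> I b -> (I ^^ n.+1) (a * b).
Proof. by move=> ha hb; apply: mem_span; exists a, b. Qed.

Lemma ipowS_min n K : idl S K -> (forall a b, (I ^^ n) a -> I b -> K (a * b)) ->
  forall z, (I ^^ n.+1) z -> K z.
Proof.
by move=> hK h z; apply: span_min => // _ [a [b [ha [hb /= ->]]]]; apply: h.
Qed.

Lemma ipow1 z : (I ^^ 1) z <-> I z.
Proof.
split=> [|h]; first by apply: ipowS_min z => // a b _; apply: idlMl.
by rewrite -[z]mul1r; apply: ipowSM.
Qed.

Lemma ipowX n x : I x -> (I ^^ n) (x ^+ n).
Proof. by move=> hx; elim: n => // n IH; rewrite exprSr; apply: ipowSM. Qed.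

Lemma ipow_le i j z : (i <= j)%N -> (I ^^ j) z -> (I ^^ i) z.
Proof.
move=> /subnK <-; elim: (j - i)%N => // k IH; rewrite addSn => h; apply: IH; move: h.
by apply: ipowS_min z; [exact: ideal_ipow | move=> a b ha _; apply: idlMr ha; exact: ideal_ipow].
Qed.

End Powers.

End Ideals.

(** * Local rings *)

Section Avoiding.
Variable S : comNzRingType.
Import GRing.Theory.
Local Open Scope ring_scope.

(** [T] is an arbitrary set, so one use of Zorn serves twice: [T = {1}] gives maximal ideals, a
    multiplicative [T] gives primes. *)
Lemma maximal_avoiding (J T : S -> Prop) : idl S J -> (forall x, J x -> ~ T x) ->
  exists P, [/\ idl S P, forall x, J x -> P x, forall x, P x -> ~ T x &
    forall Q, idl S Q -> (forall x, P x -> Q x) -> (forall x, Q x -> ~ T x) ->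
      forall x, Q x -> P x].
Proof.
move=> hJ JT.
pose good (X : set S) := [/\ idl S X, forall x, J x -> X x & forall x, X x -> ~ T x].
have [F hF totF|A [hA maxA]] := @Zorn_bigcup S (fun X => X = set0 \/ good X).
- have [[X0 FX0 gX0]|none] := pselect (exists2 X, F X & good X); last first.
    left; rewrite -subset0 => x [X FX Xx]; case: (hF X FX) => [X0|gX].
      by move: Xx; rewrite X0.
    by case: none; exists X.
  have gF X x : F X -> X x -> good X.
    by move=> FX Xx; case: (hF X FX) => // X00; move: Xx; rewrite X00.
  right; split.
  + apply: idealP.
    * by exists X0 => //; case: gX0 => /idl0.
    * move=> x y [X FX Xx] [Y FY Yy].
      case: (totF X Y FX FY) => sub.
        by exists Y => //; case: (gF Y y FY Yy) => hY _ _; apply: (idlD hY) => //; apply: sub.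
      by exists X => //; case: (gF X x FX Xx) => hX _ _; apply: (idlD hX) => //; apply: sub.
    * move=> r x [X FX Xx]; exists X => //.
      by case: (gF X x FX Xx) => hX _ _; apply: (idlMl hX).
  + by move=> x Jx; exists X0 => //; case: gX0 => _ + _; apply.
  + by move=> x [X FX Xx]; case: (gF X x FX Xx) => _ _; apply.
- have gA : good A.
    case: hA => // A0; case: (maxA J); last by right; split.
    rewrite A0; split=> // h; exact: (h 0 (idl0 hJ)).
  case: gA => hIA JA AT; exists A; split=> // Q hQ AQ QT x Qx.
  apply: contrapT => nAx; apply: (maxA Q); last by right; split=> // z /JA /AQ.
  by split=> // QA; apply: nAx; apply: QA.
Qed.

Lemma prime_avoiding (J T : S -> Prop) : idl S J -> (forall x, J x -> ~ T x) ->
  T 1 -> (forall x y, T x -> T y -> T (x * y)) ->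
  exists P, [/\ @prime_ideal (ring_sring S) P, forall x, J x -> P x & forall x, P x -> ~ T x].
Proof.
move=> hJ JT T1 TM; have [P [hP JP PT maxP]] := maximal_avoiding hJ JT.
exists P; split=> //; split=> //= [P1|x y Pxy]; first exact: (PT 1).
have meet z : ~ P z -> exists p r, P p /\ T (p + r * z).
  move=> nPz; apply: contrapT => none; apply: nPz.
  apply: (maxP (adjoin P z)); [exact: ideal_adjoin|exact: sub_adjoin| |exact: mem_adjoin].
  by move=> _ [p [r [Pp ->]]] Tz; apply: none; exists p, r.
have [|nPx] := pselect (P x); first by left.
have [|nPy] := pselect (P y); first by right.
have [p [r [Pp Tp]]] := meet x nPx; have [q [s [Pq Tq]]] := meet y nPy.
case: (PT _ _ (TM _ _ Tp Tq)).
(* By maximality both adjoined ideals meet [T]; the product of the two witnesses would lie in [T]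
   and in [P]. *)
have -> : (p + r * x) * (q + s * y) = p * (q + s * y) + ((r * x) * q + (r * s) * (x * y)) by ring.
by apply: (idlD hP); [exact: idlMr|apply: (idlD hP); exact: idlMl].
Qed.

End Avoiding.

Section Local.
Variable S : comNzRingType.
Import GRing.Theory.
Local Open Scope ring_scope.

Definition local_at (N : S -> Prop) :=
  [/\ idl S N, ~ N 1 & forall x, ~ N x -> exists y, x * y = 1].

Definition nzd (z : S) := forall c, z * c = 0 -> c = 0.

Lemma nzdI z a b : nzd z -> z * a = z * b -> a = b.
Proof. by move=> hz ab; apply/subr0_eq/hz; rewrite mulrBr ab subrr. Qed.

Lemma nzdX z k : nzd z -> nzd (z ^+ k).
Proof. by move=> hz; elim: k => [|k IH] c; rewrite ?mul1r // exprS -mulrA => /hz /IH. Qed.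

Lemma nzdMl y z : nzd (y * z) -> nzd y.
Proof. by move=> h c yc; apply: h; rewrite mulrAC yc mul0r. Qed.

(** A nonunit lies in some maximal ideal, and uniqueness makes that ideal [N]. *)
Lemma is_local_local_at N : @is_local (ring_sring S) N -> local_at N.
Proof.
move=> [[hN N1 maxN] uniqN]; split=> // x nNx; apply: contrapT => noinv.
have [||P [hP xP P1 maxP]] := @maximal_avoiding S (principal x) (eq 1).
- exact: ideal_principal.
- by move=> z [r ->] e; apply: noinv; exists r.
apply: nNx; apply/(uniqN P); last by apply: xP; exists 1; rewrite mulr1.
split=> //=; first by move=> h; apply: (P1 _ h).
by move=> J hJ J1 PJ; apply: maxP => // z Jz e; apply: J1; rewrite /= e.
Qed.

Lemma local_at_is_local N : local_at N -> @is_local (ring_sring S) N.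
Proof.
move=> [hN N1 unitN].
have proper_sub J : idl S J -> ~ J 1 -> forall z, J z -> N z.
  move=> hJ J1 z Jz; apply: contrapT => /unitN[y yz]; apply: J1.
  by rewrite -yz; apply: idlMr.
split; first by split=> // J hJ J1 _; apply: proper_sub.
move=> P [hP P1 maxP] z; split; first exact: proper_sub.
by apply: maxP => //; apply: proper_sub.
Qed.

Variables (N : S -> Prop) (hN : local_at N).

Let hNi : idl S N. Proof. by case: hN. Qed.

Lemma local_unit x : ~ N x -> exists y, x * y = 1. Proof. by case: hN => _ _; apply. Qed.

Lemma local_sub1 x : N x -> ~ N (1 - x).
Proof. by move=> Nx N1x; case: hN => _ + _; apply; rewrite -[1](subrK x); apply: idlD. Qed.

Lemma ideal_local_unit I u x : idl S I -> ~ N u -> I (u * x) -> I x.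
Proof. by move=> hI /local_unit[v uv]; apply: ideal_unit uv. Qed.

Lemma sub_maximal J z : idl S J -> ~ J 1 -> J z -> N z.
Proof.
move=> hJ J1 Jz; apply: contrapT => /local_unit[y yz]; apply: J1.
by rewrite -yz; apply: idlMr.
Qed.

Lemma mem_local_mul x y : N (x * y) -> N x \/ N y.
Proof. by move=> h; have [|/ideal_local_unit H] := pselect (N x); [left | right; apply: H h]. Qed.

(** This discards one generator: substituting [J] inside [Y + (a)] into [J N] gives
    [a = y + y' + c * a] with [c] in [N], and [1 - c] is a unit. *)
Lemma nakayama_step (J Y : S -> Prop) a : idl S J -> idl S Y -> J a ->
  (forall z, J z -> adjoin Y a z) ->
  (forall z, J z -> isum Y (@Defs.span (ring_sring S) (fun x => exists b c, [/\ J b, N c & x = b * c])) z) ->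
  forall z, J z -> Y z.
Proof.
move=> hJ hY Ja JYa JYN.
have [y [t [Yy]]] := JYN a Ja.
have : forall t, @Defs.span (ring_sring S) (fun x => exists b c, [/\ J b, N c & x = b * c]) t ->
  exists y' c, [/\ Y y', N c & t = y' + c * a].
  apply: span_min.
    apply: idealP.
    - by exists 0, 0; split; [exact: idl0|exact: idl0|ring].
    - move=> _ _ [y1 [c1 [? ? ->]]] [y2 [c2 [? ? ->]]].
      by exists (y1 + y2), (c1 + c2); split; [exact: idlD|exact: idlD|ring].
    - move=> r _ [y1 [c1 [? ? ->]]].
      by exists (r * y1), (r * c1); split; [exact: idlMl|exact: idlMl|ring].
  move=> x [b [c [/JYa[y1 [r [Yy1 ->]]] Nc ->]]].
  by exists (y1 * c), (r * c); split; [exact: idlMr|exact: idlMl|ring].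
move=> /[apply] -[y' [c [Yy' Nc ->]]] aE.
have Ya : Y a.
  apply: (ideal_local_unit hY (local_sub1 Nc)).
  have -> : (1 - c) * a = y + y' by rewrite mulrBl mul1r {1}aE; ring.
  exact: idlD.
by move=> z /JYa; apply: adjoin_min.
Qed.

Lemma nakayama (J X : S -> Prop) : idl S J -> idl S X -> @finitely_generated (ring_sring S) J ->
  (forall z, J z -> isum X (@Defs.span (ring_sring S) (fun x => exists b c, [/\ J b, N c & x = b * c])) z) ->
  forall z, J z -> X z.
Proof.
move=> hJ hX /fgP[n [g gE]] JX.
have hg i : (i < n)%N -> J (g i).
  by move=> hi; apply/gE; apply: mem_gens => //; exact: ideal_zero.
suff main k : (k <= n)%N -> (forall z, J z -> gens X g k z) -> forall z, J z -> X z.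
  apply: (main n) => // z /gE; apply: gens_min; first exact: ideal_gens.
    by move=> x <-; apply: idl0; exact: ideal_gens.
  by move=> i hi; apply: mem_gens.
elim: k => // k IH kn Jk; apply: IH; first exact: ltnW.
apply: nakayama_step Jk _ => //; [exact: ideal_gens|exact: hg|].
by move=> z /JX[x [t [Xx ? ->]]]; exists x, t; split=> //; exact: sub_gens.
Qed.

Lemma nakayama_ipow n (X : S -> Prop) : idl S X -> @finitely_generated (ring_sring S) (N ^^ n) ->
  (forall z, (N ^^ n) z -> isum X (N ^^ n.+1) z) -> forall z, (N ^^ n) z -> X z.
Proof.
move=> hX fgN h; apply: nakayama => //; first exact: ideal_ipow.
move=> z /h[x [t [Xx tN ->]]]; exists x, t; split=> //; move: t tN.
apply: ipowS_min; first exact: ideal_span.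
by move=> a b ha hb; apply: mem_span; exists a, b.
Qed.

End Local.

(** * Nonzerodivisors in a one-dimensional local ring *)

Section DimensionOne.
Variables (R : comNzRingType) (M : R -> Prop).
Import GRing.Theory.
Local Open Scope ring_scope.
Hypothesis (hM : local_at M) (dim1 : @krull_dim (ring_sring R) 1).

(** If [P] missed an element of [M], a prime inside [P] that omits [z] would complete a chain of
    three primes. *)
Lemma prime_nzd_maximal P z : @prime_ideal (ring_sring R) P -> P z -> nzd z ->
  forall x, M x -> P x.
Proof.
move=> pP Pz hz x Mx; apply: contrapT => nPx.
have [hP P1 PM] := pP; have [hMi M1 _] := hM.
(* A prime avoiding [T] lies inside [P] (take [k = 0]) and omits [z] (take [k = 1], [s = 1]); [0] is
   not in [T] because [z] is a nonzerodivisor. *)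
pose T t := exists k s, ~ P s /\ t = z ^+ k * s.
have [||||Q [pQ _ QT]] := @prime_avoiding R (eq 0) T; first exact: ideal_zero.
- move=> _ <- [k [s [Ps /esym /(nzdX hz) s0]]]; apply: Ps; rewrite s0; exact: idl0.
- by exists 0%N, 1; split=> //; rewrite mulr1.
- move=> _ _ [k [s [Ps ->]]] [l [t [Pt ->]]]; exists (k + l)%N, (s * t); split.
    by move=> /PM[].
  by rewrite exprD; ring.
case: dim1 => _; apply.
exists (fun i => if i is 0 then Q else if i is 1 then P else M); split.
  move=> [|[|[|]]] // _; split=> //= a b; exact: mem_local_mul.
have QP t : Q t -> P t.
  by move=> Qt; apply: contrapT => nPt; apply: (QT t Qt); exists 0%N, t; rewrite expr0 mul1r.
move=> [|[|]] // _; split=> //.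
- move=> PQ; apply: (QT z (PQ z Pz)); exists 1%N, 1; split=> //; by rewrite expr1 mulr1.
- by move=> t Pt; apply: (sub_maximal hM hP).
- by move=> MP; apply: nPx; apply: MP.
Qed.

Lemma power_in_principal z x : nzd z -> M x -> exists k, principal z (x ^+ k).
Proof.
move=> hz Mx; apply: contrapT => none.
have [||||P [pP zP PT]] := @prime_avoiding R (principal z) (fun t => exists k, t = x ^+ k).
- exact: ideal_principal.
- by move=> t zt [k tk]; apply: none; exists k; rewrite -tk.
- by exists 0%N.
- by move=> _ _ [k ->] [l ->]; exists (k + l)%N; rewrite exprD.
apply: (PT x); last by exists 1%N.
by apply: (prime_nzd_maximal pP _ hz Mx); apply: zP; exists 1; rewrite mulr1.
Qed.

End DimensionOne.

(** * Principal reductions of the maximal ideal *)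

Section Core.
Variables (S : comNzRingType) (N : S -> Prop) (m : S).
Import GRing.Theory.
Local Open Scope ring_scope.
Hypotheses (hN : local_at N) (Nm : N m) (hm : nzd m).

Let hNi : idl S N. Proof. by case: hN. Qed.

Lemma span2C (a b : S) z : span2 a b z -> span2 b a z.
Proof. by move=> [r [s ->]]; exists s, r; rewrite addrC. Qed.

Lemma span2_exchange (a b p : S) r s : ~ N r -> p = r * a + s * b ->
  forall z, span2 a b z -> span2 p b z.
Proof.
move=> nNr pE; apply: span2_min; [exact: ideal_span2| |exact: span2r].
apply: (ideal_local_unit hN (ideal_span2 p b) nNr).
by exists 1, (- s); rewrite pE; ring.
Qed.

(** [I/K] is a residue field space of dimension at most two, in which [p] and [q] are independent.
    Steinitz exchange with unit coefficients shows that they generate [I] itself, not only modulo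
    [K]. *)
Lemma span2_basis (I K : S -> Prop) a b p q : idl S K ->
  (forall c z, N c -> I z -> K (c * z)) -> (forall z, I z <-> span2 a b z) ->
  I p -> I q -> ~ K p -> ~ adjoin K p q -> forall z, I z -> span2 p q z.
Proof.
move=> hK NIK IE Ip Iq nKp nKq.
wlog [r [s [nNr pE]]] : a b IE / exists r s, ~ N r /\ p = r * a + s * b.
  move=> main; have /IE[r [s pE]] := Ip.
  have [Nr|nNr] := pselect (N r); last by apply: (main a b) => //; exists r, s.
  apply: (main b a) => [z|]; first by split=> [/IE /span2C //|/span2C /IE].
  exists s, r; split; last by rewrite pE addrC.
  move=> Ns; apply: nKp; rewrite pE.
  by apply: (idlD hK); apply: NIK => //; apply/IE; [exact: span2l|exact: span2r].
have abpb := span2_exchange nNr pE.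
have /IE /abpb[r' [s' qE]] := Iq.
have nNs' : ~ N s'.
  move=> Ns'; apply: nKq; exists (s' * b), r'; split; last by rewrite qE addrC.
  by apply: NIK => //; apply/IE; exact: span2r.
move=> z /IE /abpb /span2C z_bp; apply: span2C.
by apply: (span2_exchange nNs' _ z_bp); rewrite qE addrC.
Qed.

(** By Nakayama a stable power would vanish, whereas it contains the nonzero element [m ^+ n]. *)
Lemma ipow_not_stable n : @finitely_generated (ring_sring S) (N ^^ n) ->
  ~ forall z, (N ^^ n) z -> (N ^^ n.+1) z.
Proof.
move=> fgN h; suff /(nzdX hm) /eqP : m ^+ n * 1 = 0 by rewrite oner_eq0.
rewrite mulr1; apply/esym.
apply: (nakayama_ipow hN (ideal_zero S) fgN) _ (ipowX n Nm) => z hz.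
by exists 0, z; split=> //; [exact: h|rewrite add0r].
Qed.

Lemma ipow_mul_annih n c z : N c -> (N ^^ n) z -> (N ^^ n.+1) (c * z).
Proof. by move=> Nc hz; rewrite mulrC; apply: ipowSM. Qed.

(* In each case the multiplier is chosen so that it carries two elements of
   N^(k+1) to a basis of the plane N^(k+2)/N^(k+3); this needs no assumption
   on the size of the residue field. *)
Lemma ipow_principal_reduction k : @two_generated (ring_sring S) (N ^^ k.+2) ->
  exists y, N y /\ forall z, (N ^^ k.+2) z -> scale y (N ^^ k.+1) z.
Proof.
move=> two; have fgN := two_generated_fg two.
have /two_generatedP[a [b abE]] := two.
have hK := ideal_ipow N k.+3; set K := N ^^ k.+3 in hK.
have scaleI y : idl S (scale y (N ^^ k.+1)) by exact/ideal_scale/ideal_ipow.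
(* The product is split into three factors because the last case below takes [z], not [x], as
   multiplier. *)
have [v [z [x [Nv Nz Nx nKp]]]] : exists v z x, [/\ (N ^^ k) v, N z, N x & ~ K (v * z * x)].
  apply: contrapT => none; apply: (ipow_not_stable fgN).
  apply: ipowS_min => // u x Nu Nx; move: u Nu.
  apply: (@ipowS_min S N k (fun u => K (u * x))).
    by have := ideal_colon x hK; under eq_fun do rewrite mulrC.
  by move=> v z Nv Nz; apply: contrapT => nK; apply: none; exists v, z, x.
have Nu : (N ^^ k.+1) (v * z) by exact: ipowSM.
set p := v * z * x in nKp.
have Np : (N ^^ k.+2) p by exact: ipowSM.
have pE : p = x * (v * z) by rewrite mulrC.
(* If no product is independent of [p] modulo [K], then [p] alone generates modulo [K], and [x]
   works by Nakayama. *)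
have [[w [y [Nw Ny nq]]]|none] := pselect (exists w y, [/\ (N ^^ k.+1) w, N y & ~ adjoin K p (w * y)]);
  last first.
  exists x; split=> //; apply: (nakayama_ipow hN) => // t ht.
  have : adjoin K p t.
    apply: ipowS_min t ht; first exact: ideal_adjoin.
    by move=> w y Nw Ny; apply: contrapT => nK; apply: none; exists w, y.
  move=> [c [r [Kc ->]]]; exists (r * p), c; split=> //; last by rewrite addrC.
  by apply: idlMl => //; exists (v * z).
set q := w * y in nq.
have Nq : (N ^^ k.+2) q by exact: ipowSM.
have qE : q = y * w by rewrite mulrC.
have pqE t : (N ^^ k.+2) t -> span2 p q t.
  by apply: (span2_basis hK _ abE) => // c s; exact: ipow_mul_annih.
suff [y0 [Ny0 yp yq]] : exists y0, [/\ N y0, scale y0 (N ^^ k.+1) p & scale y0 (N ^^ k.+1) q].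
  by exists y0; split=> // t /pqE; apply: span2_min.
have scaleM c u : (N ^^ k.+1) u -> scale c (N ^^ k.+1) (c * u) by exists u.
(* With [u = v * z], multiplication by [x] sends [(u, w)] to [(p, al p + al' q)] and by [y] to
   [(be p + be' q, q)]. So [x] works if [al'] is a unit, and [y] works if [be] is one. *)
have [al [al' xw]] := pqE _ (ipow_mul_annih Nx Nw).
have [be [be' yu]] := pqE _ (ipow_mul_annih Ny Nu).
have [Nal'|nN] := pselect (N al'); last first.
  exists x; split=> //; first by rewrite pE; apply: scaleM.
  apply: (ideal_local_unit hN (scaleI x) nN).
  have -> : al' * q = x * w - al * (x * (v * z)) by rewrite xw -pE; ring.
  by apply: idlB => //; [|apply: idlMl => //]; apply: scaleM.
have [Nbe|nN] := pselect (N be); last first.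
  exists y; split=> //; last by rewrite qE; apply: scaleM.
  apply: (ideal_local_unit hN (scaleI y) nN).
  have -> : be * p = y * (v * z) - be' * (y * w) by rewrite yu -qE; ring.
  by apply: idlB => //; [|apply: idlMl => //]; apply: scaleM.
(* The determinant of multiplication by [x + y] from [(u, w)] to [(p, q)]; if it is a unit, Cramer's
   rule recovers [p] and [q]. *)
pose det := (1 + be) * (1 + al') - al * be'.
have eu : (x + y) * (v * z) = (1 + be) * p + be' * q by rewrite mulrDl yu -pE; ring.
have ew : (x + y) * w = al * p + (1 + al') * q by rewrite mulrDl xw -qE; ring.
have [Ndet|nN] := pselect (N det); last first.
  exists (x + y); split; first exact: idlD.
  - apply: (ideal_local_unit hN (scaleI _) nN).
    have -> : det * p = (1 + al') * ((x + y) * (v * z)) - be' * ((x + y) * w).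
      by rewrite eu ew /det; ring.
    by apply: idlB => //; apply: idlMl => //; apply: scaleM.
  - apply: (ideal_local_unit hN (scaleI _) nN).
    have -> : det * q = (1 + be) * ((x + y) * w) - al * ((x + y) * (v * z)).
      by rewrite eu ew /det; ring.
    by apply: idlB => //; apply: idlMl => //; apply: scaleM.
have nNbe' : ~ N be'.
  move=> Nbe'; case: hN => _ N1 _; apply: N1.
  have -> : 1 = det - be * (1 + al') - al' + al * be' by rewrite /det; ring.
  by apply: idlD => //; [apply: idlB => //; apply: idlB => //; exact: idlMr|exact: idlMl].
(* Since [al'], [be] and [det] all lie in [N], [al * be'] is 1 modulo [N], so [be'] is a unit. Then
   [z] reaches [p] from [v * x], and [q] from [v * y] once its [p] part is removed. *)
exists z; split=> //.
  have -> : p = z * (v * x) by rewrite /p; ring.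
  by apply: scaleM; apply: ipowSM.
apply: (ideal_local_unit hN (scaleI _) nNbe').
have -> : be' * q = z * (v * y) - be * (z * (v * x)).
  have -> : z * (v * y) = y * (v * z) by ring.
  by rewrite yu /p; ring.
by apply: idlB => //; [|apply: idlMl => //]; apply: scaleM; apply: ipowSM.
Qed.

Lemma reduction_nzd k y : (forall z, (N ^^ k) z -> scale y (N ^^ k.-1) z) -> nzd y.
Proof.
move=> /(_ _ (ipowX k Nm))[w [_ mE]]; apply: (@nzdMl _ y w); rewrite -mE; exact: nzdX.
Qed.

Lemma two_generated_ipow_pred k : @two_generated (ring_sring S) (N ^^ k.+2) ->
  @two_generated (ring_sring S) (N ^^ k.+1).
Proof.
move=> two; have [y [Ny yE]] := ipow_principal_reduction two.
have hy : nzd y by exact: (reduction_nzd yE).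
have /two_generatedP[a [b abE]] := two.
have [a' [Na' aE]] : scale y (N ^^ k.+1) a by apply/yE/abE; exact: span2l.
have [b' [Nb' bE]] : scale y (N ^^ k.+1) b by apply/yE/abE; exact: span2r.
apply/two_generatedP; exists a', b' => z; split.
  move=> Nz; have /abE[r [s yz]] := ipow_mul_annih Ny Nz.
  by exists r, s; apply: (nzdI hy); rewrite yz aE bE; ring.
by apply: span2_min => //; exact: ideal_ipow.
Qed.

(* The relation on x * x amounts to N^2 = y N. *)
Definition quadratic_pair (y x : S) :=
  [/\ nzd y, forall z, N z <-> span2 y x z & exists r s, x * x = y * (r * y + s * x)].

Lemma two_generated_ipow_quadratic_pair n : (2 <= n)%N -> @two_generated (ring_sring S) (N ^^ n) ->
  exists y x, quadratic_pair y x.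
Proof.
case: n => [|[|k]] // _ twok.
have two : @two_generated (ring_sring S) (N ^^ 2).
  by elim: k twok => // k IH /two_generated_ipow_pred.
have [y [Ny yE]] := ipow_principal_reduction two.
have hy : nzd y by exact: (reduction_nzd yE).
have /two_generatedP[a [b abE]] := two_generated_ipow_pred two.
have NabE z : N z <-> span2 a b z by rewrite -abE ipow1.
(* [y] lies outside [N^2 = y N], as [y = y * w] with [w] in [N] would force [w = 1]. Hence one of
   its coordinates is a unit, and [y] can replace a generator. *)
wlog [r [s [nNr pE]]] : a b {abE} NabE / exists r s, ~ N r /\ y = r * a + s * b.
  move=> main; have /NabE[r [s pE]] := Ny.
  have [Nr|nNr] := pselect (N r); last by apply: (main a b) => //; exists r, s.
  apply: (main b a) => [z|]; first by split=> [/NabE /span2C //|/span2C /NabE].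
  exists s, r; split; last by rewrite pE addrC.
  move=> Ns; have : (N ^^ 2) y.
    have [Na Nb] : N a /\ N b by split; apply/NabE; [exact: span2l|exact: span2r].
    by rewrite pE; apply: idlD; [exact: ideal_ipow| |]; apply: ipow_mul_annih => //; apply/ipow1.
  move=> /yE[w [/(ipow1 hNi) Nw /esym]]; rewrite -[RHS]mulr1 => /(nzdI hy) w1.
  by case: hN => _ + _; apply; rewrite -w1.
have Nb : N b by apply/NabE; exact: span2r.
have NE z : N z <-> span2 y b z.
  by split=> [/NabE /(span2_exchange nNr pE) //|]; apply: span2_min.
exists y, b; split=> //.
have /yE[w [/(ipow1 hNi) /NE[r' [s' wE]] bE]] : (N ^^ 2) (b * b).
  by apply: ipow_mul_annih => //; apply/ipow1.
by exists r', s'; rewrite -wE.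
Qed.

End Core.

(** * Maximal ideals with N = (y, x) and N^2 = y N *)

Section QuadraticPair.
Variables (S : comNzRingType) (N : S -> Prop).
Import GRing.Theory.
Local Open Scope ring_scope.
Hypothesis hN : local_at N.

Let hNi : idl S N. Proof. by case: hN. Qed.

Lemma two_generated_unit (I : S -> Prop) : idl S I -> I 1 -> @two_generated (ring_sring S) I.
Proof.
move=> hI I1; apply/two_generatedP; exists 1, 0 => z; split=> _; first by exists z, 0; ring.
by rewrite -[z]mulr1; apply: idlMl.
Qed.

Lemma scale_span2 (c a b z : S) : scale c (span2 a b) z <-> span2 (c * a) (c * b) z.
Proof.
split=> [[_ [[r [s ->]] ->]]|[r [s ->]]]; first by exists r, s; ring.
by exists (r * a + s * b); split; [exists r, s|ring].
Qed.

Lemma sub_scale_colon (I : S -> Prop) c : idl S I -> (forall t, I t -> principal c t) ->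
  forall z, I z <-> scale c (fun t => I (c * t)) z.
Proof.
move=> hI Ic z; split=> [Iz|[t [+ ->]] //].
by have [t zE] := Ic z Iz; exists t; rewrite -zE.
Qed.

Lemma two_generated_scale (I : S -> Prop) c : idl S I -> (forall t, I t -> principal c t) ->
  @two_generated (ring_sring S) (fun t => I (c * t)) -> @two_generated (ring_sring S) I.
Proof.
move=> hI Ic /two_generatedP[a [b h]]; apply/two_generatedP; exists (c * a), (c * b) => z.
apply: iff_trans (scale_span2 c a b z); apply: iff_trans (sub_scale_colon hI Ic z) _.
by split=> -[t [/h ? ->]]; exists t.
Qed.

Variables (y x : S).
Hypothesis hp : quadratic_pair N y x.

Let hy : nzd y. Proof. by case: hp. Qed.
Let NE z : N z <-> span2 y x z. Proof. by case: hp => _ ->. Qed.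
Let Ny : N y. Proof. by apply/NE; exact: span2l. Qed.
Let Nx : N x. Proof. by apply/NE; exact: span2r. Qed.

Lemma quadratic_mul a b : N a -> N b -> scale y N (a * b).
Proof.
have hI : idl S (scale y N) by exact: ideal_scale.
have yN c : N c -> scale y N (y * c) by exists c.
have [_ _ [r0 [s0 x2]]] := hp.
move=> /NE[r [s ->]] Nb; rewrite mulrDl; apply: idlD => //.
  by rewrite -mulrA mulrCA; apply: yN; exact: idlMl.
rewrite -mulrA; apply: idlMl => //; case/NE: Nb => [r' [s' ->]].
have -> : x * (r' * y + s' * x) = y * (r' * x) + s' * (x * x) by ring.
apply: idlD => //; first by apply: yN; exact: idlMl.
by apply: idlMl => //; rewrite x2; apply: yN; apply/NE; exists r0, s0.
Qed.

(** The coefficient of [x] in [w] is a unit: otherwise that term would lie in [N^2], hence in [yS],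
    and [w] with it. *)
Lemma quadratic_pair_change w : N w -> ~ principal y w -> quadratic_pair N y w.
Proof.
move=> Nw nyw; have hyI : idl S (principal y) by exact: ideal_principal.
have NwE z : N z <-> span2 y w z.
  split; last exact: span2_min.
  have [r [s wE]] := (NE w).1 Nw.
  have nNs : ~ N s.
    move=> Ns; apply: nyw; rewrite wE; apply: idlD => //.
      by apply: idlMl => //; exists 1; rewrite mulr1.
    by have [t [_ ->]] := quadratic_mul Ns Nx; exists t.
  move=> /NE /span2C h; apply: span2C.
  by apply: (span2_exchange hN nNs _ h); rewrite wE addrC.
split=> //; have [t [/NwE[r [s tE]] wwE]] := quadratic_mul Nw Nw.
by exists r, s; rewrite -tE.
Qed.

(* The quotient by w has principal maximal ideal (y), so its elements are
   units times powers of y, up to a high power of y. *)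
Lemma quadratic_expand w j t : N w -> ~ principal y w ->
  span2 w (y ^+ j) t \/ exists i u s, [/\ (i < j)%N, ~ N u & t = y ^+ i * u + w * s].
Proof.
move=> Nw /(quadratic_pair_change Nw)[_ NwE _].
elim: j => [|j [[r [s ->]]|[i [u [s [ij nNu ->]]]]]].
- by left; exists 0, t; rewrite expr0; ring.
- have [Ns|nNs] := pselect (N s); last first.
    by right; exists j, s, r; split=> //; ring.
  have /NwE[r' [s' ->]] := Ns; left; exists (r + s' * y ^+ j), r'; rewrite exprS; ring.
- by right; exists i, u, s; split=> //; exact: ltnW.
Qed.

Lemma two_generated_of_power (I : S -> Prop) k : idl S I -> I (y ^+ k) ->
  @two_generated (ring_sring S) I.
Proof.
elim: k I => [|k IH] I hI Iyk; first exact: two_generated_unit.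
have [Iy|/existsNP[w /not_implyP[Iw nyw]]] := pselect (forall t, I t -> principal y t).
  apply: (two_generated_scale hI Iy); apply: IH; first exact: ideal_colon.
  by rewrite -exprS.
have [Nw|nNw] := pselect (N w); last first.
  by apply: two_generated_unit => //; apply: (ideal_local_unit hN hI nNw); rewrite mulr1.
have ex : exists j, `[< I (y ^+ j) >] by exists k.+1; apply/asboolP.
case: (ex_minnP ex) => j /asboolP Iyj jmin.
(* An element of [I] outside [(w, y^j)] would be, modulo [w], a unit times [y^i] with [i < j],
   against the minimality of [j]. *)
apply/two_generatedP; exists w, (y ^+ j) => z; split; last exact: span2_min.
move=> Iz; have [//|[i [u [s [ij nNu zE]]]]] := quadratic_expand j z Nw nyw.
suff /asboolP /jmin : I (y ^+ i) by rewrite leqNgt ij.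
apply: (ideal_local_unit hN hI nNu); rewrite mulrC.
have -> : y ^+ i * u = z - w * s by rewrite zE; ring.
by apply: idlB => //; apply: idlMr.
Qed.

(** * Ideals and primes when the ring is [y]-adically complete *)

Section Complete.
Hypothesis sep : forall c, (forall j, principal (y ^+ j) c) -> c = 0.
Hypothesis compl : forall s : nat -> S, (forall j, principal (y ^+ j) (s j.+1 - s j)) ->
  exists c, forall j, principal (y ^+ j) (c - s j).

(** Successive approximation: if [t - w * s = y^j * a], then [a] is in [N = (y, w)], since otherwise
    [y^j] would lie in [I]. The [w] part of [a] corrects [s] and leaves an error divisible by
    [y^(j+1)]. *)
Lemma principal_of_no_power (I : S -> Prop) w : idl S I -> I w -> ~ principal y w ->
  (forall j, ~ I (y ^+ j)) -> forall t, I t -> principal w t.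
Proof.
move=> hI Iw nyw nIy t It.
have Nw : N w.
  apply: contrapT => nNw; apply: (nIy 0%N); rewrite expr0.
  by apply: (ideal_local_unit hN hI nNw); rewrite mulr1.
have [_ NwE _] := quadratic_pair_change Nw nyw.
pose approx j s := principal (y ^+ j) (t - w * s).
(* Stated for every pair, with 0 as default when [s] is not an approximation, so that [choice]
   yields a total function to iterate. *)
have step (js : nat * S) : exists s', approx js.1 js.2 ->
    approx js.1.+1 s' /\ principal (y ^+ js.1) (s' - js.2).
  case: js => j s /=; have [[a tE]|nap] := pselect (approx j s); last by exists 0.
  have /NwE[al [be aE]] : N a.
    apply: contrapT => nNa; apply: (nIy j); apply: (ideal_local_unit hN hI nNa).
    by rewrite mulrC -tE; apply: idlB => //; apply: idlMr.
  exists (s + y ^+ j * be) => _; split; last by exists be; ring.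
  exists al; rewrite exprSr.
  have -> : t - w * (s + y ^+ j * be) = (t - w * s) - w * y ^+ j * be by ring.
  by rewrite tE aE; ring.
have [f fP] := choice step.
pose s := fix s j := if j is j'.+1 then f (j', s j') else 0.
have sP j : approx j (s j).
  elim: j => [|j IH]; first by exists (t - w * 0); rewrite expr0 mul1r.
  by have [] := fP (j, s j) IH.
have [|c cP] := compl (s := s); first by move=> j; have [] := fP (j, s j) (sP j).
exists c; apply/subr0_eq/sep => j.
have -> : t - w * c = (t - w * s j) - w * (c - s j) by ring.
apply: idlB; [exact: ideal_principal|exact: sP|apply: idlMl => //; exact: ideal_principal].
Qed.

Lemma complete_two_generated (I : S -> Prop) : idl S I -> @two_generated (ring_sring S) I.
Proof.
move=> hI.
have [I0|/existsNP[t0 /not_implyP[It0 nt0]]] := pselect (forall t, I t -> t = 0).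
  apply/two_generatedP; exists 0, 0 => z; split=> [/I0 ->|[r [s ->]]]; first exact: span2l.
  by rewrite !mulr0 addr0; exact: idl0.
have [J nJ] : exists j, ~ principal (y ^+ j) t0.
  by apply: contrapT => none; apply: nt0; apply: sep => j; apply: contrapT => nj; apply: none; exists j.
(* The least exponent that fails for some element of [I] is some [j.+1]; then [I] can be divided by
   [y^j], and the quotient ideal contains an element outside [yS]. *)
have ex : exists j, `[< exists2 t, I t & ~ principal (y ^+ j) t >].
  by exists J; apply/asboolP; exists t0.
case: (ex_minnP ex) => -[|j] /asboolP[t It nt] jmin.
  by case: nt; exists t; rewrite expr0 mul1r.
have Ij : forall u, I u -> principal (y ^+ j) u.
  move=> u Iu; apply: contrapT => nu.
  have /jmin : `[< exists2 t, I t & ~ principal (y ^+ j) t >] by apply/asboolP; exists u.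
  by rewrite ltnn.
apply: (two_generated_scale hI Ij).
have hI' := ideal_colon (y ^+ j) hI; set I' := (fun t => I (y ^+ j * t)) in hI' *.
have [w tE] := Ij t It.
have I'w : I' w by rewrite /I' -tE.
have nyw : ~ principal y w.
  by move=> [r wE]; apply: nt; exists r; rewrite tE wE exprSr mulrA.
have [[k I'k]|none] := pselect (exists k, I' (y ^+ k)).
  exact: two_generated_of_power I'k.
apply/two_generatedP; exists w, 0 => z; split.
  move=> /(principal_of_no_power hI' I'w nyw) -[|r ->]; first by move=> k I'k; apply: none; exists k.
  by exists r, 0; ring.
by apply: span2_min => //; exact: idl0.
Qed.

Lemma complete_noetherian : @noetherian (ring_sring S).
Proof. by move=> I hI; apply: two_generated_fg; exact: complete_two_generated. Qed.

Lemma complete_dim_lt2 : ~ @krull_dim_ge (ring_sring S) 2.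
Proof.
move=> [P [/= primeP chainP]].
have [hP0 _ P0M] := primeP 0%N isT.
have pr1 := primeP 1%N isT; have [hP1 P11 P1M] := pr1.
have [hP2 P21 _] := primeP 2%N isT.
have [P01 nP10] := chainP 0%N isT; have [P12 nP21] := chainP 1%N isT.
move: (P 0%N) (P 1%N) (P 2%N) => P0 P1 P2 in hP0 P0M pr1 hP1 P11 P1M hP2 P21 P01 nP10 P12 nP21 *.
(* [x * x] is a multiple of [y], so a prime containing [y] contains [N]. *)
have nP1y : ~ P1 y.
  move=> P1y; apply: nP21 => z P2z.
  have P1x : P1 x.
    have [_ _ [r [s x2]]] := hp.
    by case: (P1M x x) => //=; rewrite x2; apply: (idlMr hP1).
  have /NE : N z by apply: (sub_maximal hN hP2).
  by apply: span2_min.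
have nP1yj j : ~ P1 (y ^+ j) by elim: j => [|j IH] //; rewrite exprS => /P1M[].
have P1div t : P1 (y * t) -> P1 t by move=> /P1M[].
(* Otherwise [P1 = y P1], so [P1] lies in every [y^j S] and vanishes by separation. *)
have [w [P1w nyw]] : exists w, P1 w /\ ~ principal y w.
  apply: contrapT => none.
  have P1y t : P1 t -> principal y t.
    by move=> P1t; apply: contrapT => nyt; apply: none; exists t.
  apply: nP10 => z P1z; suff -> : z = 0 by exact: (idl0 hP0).
  apply: sep => j; suff [t [P1t ->]] : exists t, P1 t /\ z = y ^+ j * t by exists t.
  elim: j => [|j [t [P1t zE]]]; first by exists z; rewrite expr0 mul1r.
  have [t' tE] := P1y t P1t; exists t'; split; first by apply: P1div; rewrite -tE.
  by rewrite exprSr -mulrA -tE.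
have P1E := principal_of_no_power hP1 P1w nyw nP1yj.
have Nw : N w by apply: (sub_maximal hN hP1).
have nP0w : ~ P0 w.
  by move=> P0w; apply: nP10 => z /P1E[r ->]; apply: (idlMr hP0).
(* The quadratic relation for [w] puts [al] in [P1 = wS]. It then reads [w * e = 0], and [e] falls
   into [P0] because [w] does not. *)
have [_ _ [al [be w2]]] := quadratic_pair_change Nw nyw.
have [al' alE] : principal w al.
  apply: P1E; apply/P1div/P1div.
  have -> : y * (y * al) = w * w - w * (y * be) by rewrite w2; ring.
  by apply: (idlB hP1); apply: (idlMr hP1).
pose e := w - y * (al' * y + be).
have P0e : P0 e.
  have : P0 (w * e).
    have -> : w * e = w * w - y * (w * al' * y + be * w) by rewrite /e; ring.
    by rewrite -alE w2 subrr; exact: (idl0 hP0).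
  by case/P0M.
(* Writing [e = w * s] with [s] in [N] makes [(1 - s) * w] a multiple of [y], which contradicts the
   choice of [w]. *)
have [s eE] := P1E e (P01 e P0e).
have Ns : N s.
  apply: (sub_maximal hN hP1) => //; apply: P01.
  by move: P0e; rewrite eE => /P0M[].
apply: nyw; apply: (ideal_local_unit hN (ideal_principal y) (local_sub1 hN Ns)).
exists (al' * y + be); rewrite mulrBl mul1r [s * w]mulrC -eE /e; ring.
Qed.

End Complete.

End QuadraticPair.

(** * Length and multiplicity *)

Section Length.
Variable S : comNzRingType.
Import GRing.Theory.
Local Open Scope ring_scope.
Notation chain := (@chain_ge (ring_sring S)).
Notation qlen := (@quot_length (ring_sring S)).

Lemma eq_ideal (I J : S -> Prop) : (forall z, I z <-> J z) -> I = J.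
Proof. by move=> h; apply/funext => z; apply/propext. Qed.

Lemma chain_ge_cons (X J : S -> Prop) l : idl S X -> (forall z, X z -> J z) ->
  ~ (forall z, J z -> X z) -> chain J l -> chain X l.+1.
Proof.
move=> hX XJ nJX [I [hI sI]]; exists (fun i => if i is i'.+1 then I i' else X); split.
  case=> [|i] hi; first by split.
  by have [? JI] := hI i hi; split=> // z /XJ /JI.
case=> [|i] hi; last exact: sI.
have [_ JI] := hI 0%N isT; split=> [z /XJ /JI //|IX].
by apply: nJX => z /JI /IX.
Qed.

Lemma chain_ge_sub (X J : S -> Prop) l : (forall z, X z -> J z) -> chain J l -> chain X l.
Proof.
move=> XJ [I [hI sI]]; exists I; split=> // i /hI[? JI]; split=> // z /XJ; exact: JI.
Qed.

Lemma chain_ge_pred (J : S -> Prop) l : chain J l.+1 -> chain J l.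
Proof.
move=> [I [hI sI]]; exists I; split=> i hi; [apply: hI|apply: sI] => //; exact: leqW.
Qed.

Lemma chain_ge_le (J : S -> Prop) l l' : (l <= l')%N -> chain J l' -> chain J l.
Proof.
by move=> /subnK <-; elim: (l' - l)%N => // k IH; rewrite addSn => /chain_ge_pred.
Qed.

Lemma quot_length_chain_le (J : S -> Prop) l l' : qlen J l -> chain J l' -> (l' <= l)%N.
Proof.
by move=> [_ nJ] cJ; rewrite leqNgt; apply/negP => lt; apply: nJ; apply: chain_ge_le cJ.
Qed.

Lemma quot_length_True : qlen (fun=> True) 0.
Proof.
split; first by exists (fun _ _ => True); split=> // i _; split=> //; exact: ideal_True.
by move=> [I [hI sI]]; have [_ []] := sI 0%N isT => z _; have [_] := hI 0%N isT; apply.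
Qed.

Variables (N : S -> Prop) (hN : local_at N).

(** [N] kills the class of [a] modulo [X], so [(X + (a))/X] has length at most one and adjoining [a]
    costs at most one step of a chain. *)
Lemma chain_ge_adjoin (X : S -> Prop) a l : idl S X -> (forall c, N c -> X (c * a)) ->
  chain X l.+1 -> chain (adjoin X a) l.
Proof.
move=> hX NaX [I [hI sI]].
have XI i : (i <= l.+1)%N -> forall z, X z -> I i z by move=> /hI[_].
have idI i : (i <= l.+1)%N -> idl S (I i) by move=> /hI[].
(* [a] is adjoined until it enters the chain; from there the index is shifted, which skips the
   single inclusion that may collapse. *)
exists (fun i => if `[< I i a >] then I i.+1 else adjoin (I i) a); split=> i hi.
  case: asboolP => Ia; split.
  - exact: idI.
  - apply: adjoin_min; [exact: idI|exact: XI|].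
    by have [h _] := sI i hi; apply: h.
  - by apply: ideal_adjoin; apply: idI; exact: leqW.
  - by move=> _ [x [r [/(XI _ (leqW hi)) ? ->]]]; exists x, r.
have [sub nsub] := sI i (ltnW hi); have [sub1 nsub1] := sI i.+1 hi.
have hIi := idI i (leqW (ltnW hi)); have hIi1 := idI i.+1 (ltnW hi).
case: (asboolP (I i a)) => Ia.
  by case: asboolP => [//|]; case; exact: sub.
case: (asboolP (I i.+1 a)) => Ia1.
  have sub' : forall z, adjoin (I i) a z -> I i.+1 z by exact: adjoin_min.
  by split=> [z /sub' /sub1 //|h]; apply: nsub1 => z /h; exact: sub'.
split=> [_ [t [r [/sub ? ->]]]|h]; first by exists t, r.
apply: nsub => t It; have [t' [r [It' tE]]] := h t (sub_adjoin a It).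
have Ira : I i.+1 (r * a).
  have -> : r * a = t - t' by rewrite tE; ring.
  by apply: (idlB hIi1) => //; exact: sub.
rewrite tE; apply: (idlD hIi) => //; have [Nr|nNr] := pselect (N r).
  by apply: XI; [exact: leqW (ltnW hi)|exact: NaX].
by case: Ia1; exact: (ideal_local_unit hN hIi1 nNr).
Qed.

Lemma quot_length_adjoin (X J : S -> Prop) a l : idl S X -> ~ X a ->
  (forall c, N c -> X (c * a)) -> (forall z, J z <-> adjoin X a z) ->
  qlen J l -> qlen X l.+1.
Proof.
move=> hX nXa NaX /eq_ideal -> [cJ ncJ]; split; last by move=> /(chain_ge_adjoin hX NaX).
apply: chain_ge_cons cJ => // [z|h]; first exact: sub_adjoin.
by apply: nXa; apply: h; exact: mem_adjoin.
Qed.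

Lemma quot_length_maximal : qlen N 1.
Proof.
have [hNi N1 _] := hN; apply: (@quot_length_adjoin N (fun=> True) 1) => //.
- by move=> c; rewrite mulr1.
- by move=> z; split=> // _; exists 0, z; split; [exact: idl0|ring].
- exact: quot_length_True.
Qed.

Lemma local_at_prime : @prime_ideal (ring_sring S) N.
Proof. by have [hNi N1 _] := hN; split=> // a b; exact: mem_local_mul. Qed.

Lemma krull_dim_le1 : ~ @krull_dim_ge (ring_sring S) 2 ->
  exists2 d, (d <= 1)%N & @krull_dim (ring_sring S) d.
Proof.
move=> n2; have [d1|nd1] := pselect (@krull_dim_ge (ring_sring S) 1); first by exists 1%N.
by exists 0%N => //; split=> //; exists (fun=> N); split=> // i _; exact: local_at_prime.
Qed.

Section Pair.
Variables (y x : S).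
Hypothesis hp : quadratic_pair N y x.

Let hNi : idl S N. Proof. by case: hN. Qed.
Let hy : nzd y. Proof. by case: hp. Qed.
Let NE z : N z <-> span2 y x z. Proof. by case: hp => _ ->. Qed.
Let Ny : N y. Proof. by apply/NE; exact: span2l. Qed.
Let Nx : N x. Proof. by apply/NE; exact: span2r. Qed.

Lemma ipow_quadratic k z : (N ^^ k.+1) z <-> scale (y ^+ k) N z.
Proof.
split; last first.
  by move=> [t [Nt ->]]; apply: ipowSM => //; exact: ipowX.
elim: k z => [|k IH] z; first by rewrite ipow1 // => Nz; exists z; rewrite expr0 mul1r.
apply: ipowS_min z; first exact: ideal_scale.
move=> _ b /IH[a [Na ->]] Nb; have [t [Nt abE]] := quadratic_mul hN hp Na Nb.
by exists t; split=> //; rewrite exprSr -!mulrA abE.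
Qed.

Lemma quot_length_quadratic : exists2 e, (0 < e <= 2)%N &
  forall k, qlen (N ^^ k.+1) (1 + e * k)%N.
Proof.
have start : qlen (N ^^ 1) 1.
  by rewrite (eq_ideal (ipow1 hNi)); exact: quot_length_maximal.
have hX k := ideal_ipow N k.
have Nyk k c : N c -> (N ^^ k.+2) (c * y ^+ k.+1).
  by move=> Nc; apply/ipow_quadratic; exists c; rewrite mulrC.
have nyk k : ~ (N ^^ k.+2) (y ^+ k.+1).
  move=> /ipow_quadratic[w [Nw /esym]]; rewrite -[RHS]mulr1 => /(nzdI (nzdX hy)) w1.
  by case: hN => _ + _; apply; rewrite -w1.
(* If [y] divides [x], then [N = (y)] and the layer [N^(k+1)/N^(k+2)] is a line spanned by
   [y^(k+1)]. *)
have [[r0 xE]|nyx] := pselect (principal y x).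
  exists 1%N => // k; rewrite mul1n; elim: k => // k IH.
  apply: (quot_length_adjoin (hX k.+2) (nyk k) (Nyk k) _ IH) => z; split.
    move=> /ipow_quadratic[t [/NE[r [s ->]] ->]]; exists 0, (r + s * r0); split.
      exact: idl0 (hX _).
    by rewrite xE exprSr; ring.
  apply: adjoin_min => // [t|]; first exact: ipow_le.
  exact: ipowX.
(* Now the layer also needs [y^k * x], independent of [y^(k+1)] because [y] does not divide [x]. *)
exists 2%N => // k; elim: k => // k IH.
have -> : (1 + 2 * k.+1 = (1 + 2 * k).+2)%N by rewrite mulnS.
have hX1 := ideal_adjoin (y ^+ k.+1) (hX k.+2).
apply: (quot_length_adjoin (hX k.+2) (nyk k) (Nyk k) (fun z => iff_refl _)).
apply: (quot_length_adjoin (a := y ^+ k * x) hX1 _ _ _ IH).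
- move=> [_ [r [/ipow_quadratic[w [_ ->]] xE]]]; apply: nyx; exists (w + r).
  by apply: (nzdI (nzdX (k := k) hy)); rewrite xE exprSr; ring.
- move=> c Nc; apply: sub_adjoin; apply/ipow_quadratic.
  have [t [Nt cx]] := quadratic_mul hN hp Nc Nx; exists t; split=> //.
  by rewrite exprSr mulrCA cx mulrA.
- move=> z; split.
    move=> /ipow_quadratic[_ [/NE[r [s ->]] ->]].
    exists (r * y ^+ k.+1), s; split; last by rewrite exprSr; ring.
    by exists 0, r; split; [exact: idl0 (hX _)|ring].
  apply: adjoin_min => //.
    apply: adjoin_min => // [t|]; first exact: ipow_le.
    exact: ipowX.
  by apply/ipow_quadratic; exists x.
Qed.

Lemma quadratic_multiplicity : ~ @krull_dim_ge (ring_sring S) 2 ->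
  exists e, @multiplicity (ring_sring S) e /\ (e <= 2)%R.
Proof.
move=> /krull_dim_le1[d d1 hd]; have [e /andP[e0 e2] he] := quot_length_quadratic.
(* The dimensions 0 and 1 have the same factorial, so both give the same multiplicity. *)
have d1E : d`!%N = 1%N by case: d d1 {hd} => [|[|]].
exists e%:R; split; last by rewrite (Num.Theory.ler_nat _ e 2).
(* This is [1 + e (k - 1)] as a polynomial in [k], valid from [k = 1]; [e > 0] makes [e] its leading
   coefficient. *)
pose P : {poly rat} := (e%:R)%:P * 'X + (1 - e%:R)%:P.
have Pe : lead_coef P = e%:R.
  have e0' : (e%:R)%:P != 0 :> {poly rat} by rewrite polyC_eq0 Num.Theory.pnatr_eq0 -lt0n.
  rewrite lead_coefDl ?lead_coefMX ?lead_coefC //.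
  by rewrite size_mulX // size_polyC (leq_ltn_trans (leq_b1 _)) // ltnS size_poly_gt0.
exists N, d, P; split=> //; first exact: local_at_is_local.
- exists 1%N => -[|k] // _; exists (1 + e * k)%N; split; first exact: he.
  by rewrite hornerD hornerM !hornerC hornerX natrD natrM -natr1; ring.
- by rewrite d1E Pe mul1r.
Qed.

End Pair.

End Length.

(** * The completion as a ring *)

Section CompletionRing.
Variables (R : comNzRingType) (m : R).
Import GRing.Theory.
Local Open Scope ring_scope.
Local Open Scope quotient_scope.
Notation CS := {classic (cseq m)}.

Lemma ceqv_pointwise (f g : cseq m) : (forall k, proj1_sig f k = proj1_sig g k) -> ceqv f g.
Proof. by move=> h k; exists 0; rewrite h subrr mulr0. Qed.

Lemma ceqv_refl (f : cseq m) : ceqv f f. Proof. exact: ceqv_pointwise. Qed.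

Lemma ceqv_sym (f g : cseq m) : ceqv f g -> ceqv g f.
Proof. by move=> h k; have [r e] := h k; exists (- r); rewrite mulrN -e opprB. Qed.

Lemma ceqv_trans (f g h : cseq m) : ceqv f g -> ceqv g h -> ceqv f h.
Proof.
move=> fg gh k; have [r e] := fg k; have [s e'] := gh k; exists (r + s).
by rewrite mulrDr -e -e'; ring.
Qed.

Lemma ceqv_cadd (f f' g g' : cseq m) : ceqv f f' -> ceqv g g' -> ceqv (cadd f g) (cadd f' g').
Proof.
move=> ff gg k; have [r e] := ff k; have [s e'] := gg k; exists (r + s).
by rewrite mulrDr -e -e' /=; ring.
Qed.

Lemma ceqv_copp (f f' : cseq m) : ceqv f f' -> ceqv (copp f) (copp f').
Proof. by move=> ff k; have [r e] := ff k; exists (- r); rewrite mulrN -e /=; ring. Qed.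

Lemma ceqv_cmul (f f' g g' : cseq m) : ceqv f f' -> ceqv g g' -> ceqv (cmul f g) (cmul f' g').
Proof.
move=> ff gg k; have [r e] := ff k; have [s e'] := gg k.
exists (r * proj1_sig g k + proj1_sig f' k * s).
by rewrite mulrDr mulrA -e mulrCA -e' /=; ring.
Qed.

Definition ceqvb (f g : CS) : bool := `[< @ceqv R m f g >].

Lemma ceqvb_equiv : equiv_class_of ceqvb.
Proof.
split=> [f|f g|g f h]; first by apply/asboolP; exact: ceqv_refl.
- by apply/asboolP/asboolP; exact: ceqv_sym.
- by move=> /asboolP fg /asboolP gh; apply/asboolP; exact: ceqv_trans gh.
Qed.

Canonical ceqvb_canonical := EquivRelPack ceqvb_equiv.

(** Passing to the quotient replaces [ceqv] by Leibniz equality, so that the ideal theory above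
    applies to the completion. *)
Definition cquot := {eq_quot ceqvb}.
HB.instance Definition _ := Choice.on cquot.

Definition cpi (f : cseq m) : cquot := \pi_{eq_quot ceqvb} (f : CS).
Definition crep (c : cquot) : cseq m := repr (c : {eq_quot ceqvb}).

Lemma cpi_rep c : cpi (crep c) = c. Proof. exact: reprK. Qed.

Lemma cpiP f g : cpi f = cpi g <-> ceqv f g.
Proof.
split=> [/eqP|h]; first by rewrite /cpi eqmodE => /asboolP.
by apply/eqP; rewrite /cpi eqmodE; apply/asboolP.
Qed.

Lemma crep_pi f : ceqv (crep (cpi f)) f. Proof. by apply/cpiP; exact: cpi_rep. Qed.

Lemma cpi_surj c : exists f, c = cpi f. Proof. by exists (crep c); rewrite cpi_rep. Qed.

Definition cqadd (a b : cquot) := cpi (cadd (crep a) (crep b)).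
Definition cqopp (a : cquot) := cpi (copp (crep a)).
Definition cqmul (a b : cquot) := cpi (cmul (crep a) (crep b)).

Lemma cpi_add f g : cqadd (cpi f) (cpi g) = cpi (cadd f g).
Proof. by apply/cpiP/ceqv_cadd; exact: crep_pi. Qed.
Lemma cpi_opp f : cqopp (cpi f) = cpi (copp f).
Proof. by apply/cpiP/ceqv_copp; exact: crep_pi. Qed.
Lemma cpi_mul f g : cqmul (cpi f) (cpi g) = cpi (cmul f g).
Proof. by apply/cpiP/ceqv_cmul; exact: crep_pi. Qed.

Lemma cqaddA : associative cqadd.
Proof.
move=> a b c; have [[[f ->] [g ->]] [h ->]] := (cpi_surj a, cpi_surj b, cpi_surj c).
by rewrite !cpi_add; apply/cpiP/ceqv_pointwise => k /=; rewrite addrA.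
Qed.

Lemma cqaddC : commutative cqadd.
Proof.
move=> a b; have [[f ->] [g ->]] := (cpi_surj a, cpi_surj b).
by rewrite !cpi_add; apply/cpiP/ceqv_pointwise => k /=; rewrite addrC.
Qed.

Lemma cqadd0 : left_id (cpi (cconst m 0)) cqadd.
Proof.
move=> a; have [f ->] := cpi_surj a.
by rewrite !cpi_add; apply/cpiP/ceqv_pointwise => k /=; rewrite add0r.
Qed.

Lemma cqaddN : left_inverse (cpi (cconst m 0)) cqopp cqadd.
Proof.
move=> a; have [f ->] := cpi_surj a.
by rewrite cpi_opp !cpi_add; apply/cpiP/ceqv_pointwise => k /=; rewrite addNr.
Qed.

Lemma cqmulA : associative cqmul.
Proof.
move=> a b c; have [[[f ->] [g ->]] [h ->]] := (cpi_surj a, cpi_surj b, cpi_surj c).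
by rewrite !cpi_mul; apply/cpiP/ceqv_pointwise => k /=; rewrite mulrA.
Qed.

Lemma cqmulC : commutative cqmul.
Proof.
move=> a b; have [[f ->] [g ->]] := (cpi_surj a, cpi_surj b).
by rewrite !cpi_mul; apply/cpiP/ceqv_pointwise => k /=; rewrite mulrC.
Qed.

Lemma cqmul1 : left_id (cpi (cconst m 1)) cqmul.
Proof.
move=> a; have [f ->] := cpi_surj a.
by rewrite !cpi_mul; apply/cpiP/ceqv_pointwise => k /=; rewrite mul1r.
Qed.

Lemma cqmulDl : left_distributive cqmul cqadd.
Proof.
move=> a b c; have [[[f ->] [g ->]] [h ->]] := (cpi_surj a, cpi_surj b, cpi_surj c).
rewrite !(cpi_mul, cpi_add); apply/cpiP/ceqv_pointwise => k /=; exact: mulrDl.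
Qed.

HB.instance Definition _ := GRing.isZmodule.Build cquot cqaddA cqaddC cqadd0 cqaddN.

(** [1 != 0] is read off at level 1, where it says that [m] is not a unit; the ring structure is
    packed inside the proof, where this hypothesis is available. *)
Lemma completion_ring : ~ principal m 1 -> exists (C : comNzRingType) (pi : cseq m -> C),
  [/\ forall c, exists f, c = pi f, forall f g, pi f = pi g <-> ceqv f g,
      [/\ forall f g, pi (cadd f g) = pi f + pi g, forall f, pi (copp f) = - pi f &
          forall f g, pi (cmul f g) = pi f * pi g],
      pi (cconst m 0) = 0 & pi (cconst m 1) = 1].
Proof.
move=> nm.
have cq10 : cpi (cconst m 1) != 0.
  apply/eqP => /cpiP /(_ 1%N)[r /=]; rewrite subr0 expr1 => e; apply: nm.
  by exists r.
pose mx := GRing.Zmodule_isComNzRing.Build cquot cqmulA cqmulC cqmul1 cqmulDl cq10.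
pose C : comNzRingType := HB.pack cquot mx.
exists C, cpi; split=> //; first exact: cpi_surj.
- exact: cpiP.
- by split=> [f g|f|f g]; rewrite -?cpi_add -?cpi_opp -?cpi_mul.
Qed.

End CompletionRing.

(** * Invariance of ideals, length and multiplicity under isomorphism of setoid rings *)

Section Transfer.

(** A bare [sring] carries no axioms; these are the laws on which the transport relies. *)
Definition sring_equiv (A : sring) :=
  [/\ forall x : A, seqv x x, forall x y : A, seqv x y -> seqv y x,
      forall x y z : A, seqv x y -> seqv y z -> seqv x z &
      forall x x' y y' : A, seqv x x' -> seqv y y' -> seqv (sadd x y) (sadd x' y')].

Definition sring_hom (A B : sring) (f : A -> B) :=
  [/\ forall x y, seqv x y -> seqv (f x) (f y), seqv (f (s0 A)) (s0 B), seqv (f (s1 A)) (s1 B),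
      forall x y, seqv (f (sadd x y)) (sadd (f x) (f y)) &
      forall x y, seqv (f (smul x y)) (smul (f x) (f y))].

Definition sring_iso (A B : sring) (f : A -> B) (g : B -> A) :=
  [/\ sring_equiv A, sring_equiv B, sring_hom f, sring_hom g &
      (forall x, seqv (g (f x)) x) /\ (forall y, seqv (f (g y)) y)].

Lemma sring_iso_sym (A B : sring) (f : A -> B) g : sring_iso f g -> sring_iso g f.
Proof. by move=> [? ? ? ? []]; split. Qed.

Definition saturated (A : sring) (I : A -> Prop) := forall x y, seqv x y -> I x -> I y.

Lemma ideal_saturated (A : sring) (I : A -> Prop) : is_ideal I -> saturated I.
Proof. by case. Qed.

Lemma span_saturated (A : sring) (G : A -> Prop) : sring_equiv A -> saturated (Defs.span G).
Proof.
move=> [_ sym trans _] x y xy [n [r [a [Ga xE]]]]; exists n, r, a; split=> //.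
exact: trans (sym _ _ xy) xE.
Qed.

Lemma ipow_saturated (A : sring) (I : A -> Prop) n : sring_equiv A -> saturated (ipow I n).
Proof. by case: n => [|n] hA //; exact: span_saturated. Qed.

Lemma span_hom (A B : sring) (f : A -> B) (G : A -> Prop) (H : B -> Prop) :
  sring_equiv B -> sring_hom f -> (forall a, G a -> H (f a)) ->
  forall z, Defs.span G z -> Defs.span H (f z).
Proof.
move=> [refl sym trans addc] [fe f0 _ fD fM] GH z [n [r [a [Ga zE]]]].
exists n, (fun i => f (r i)), (fun i => f (a i)); split; first by move=> i /Ga /GH.
apply: (trans) (fe _ _ zE) _; elim: n {zE Ga} => //= n IH.
by apply: (trans) (fD _ _) _; apply: addc.
Qed.

(** As an equality of predicates, this lets a round trip through the isomorphism be removed by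
    rewriting. *)
Lemma iso_saturated_id (A B : sring) (f : A -> B) g (I : A -> Prop) :
  sring_iso f g -> saturated I -> (fun x => I (g (f x))) = I.
Proof.
move=> [[_ sym _ _] _ _ _ [gf _]] sI; apply/funext => x; apply/propext.
by split; apply: sI => //; apply: sym.
Qed.

Section IsoBasic.
Variables (A B : sring) (f : A -> B) (g : B -> A).
Hypothesis iso : sring_iso f g.

Let sym (y z : A) : seqv y z -> seqv z y. Proof. by case: iso => -[? h]; auto. Qed.
Let homg : sring_hom g. Proof. by case: iso. Qed.
Let gf x : seqv (g (f x)) x. Proof. by case: iso => _ _ _ _ []. Qed.
Let fg y : seqv (f (g y)) y. Proof. by case: iso => _ _ _ _ []. Qed.

Lemma iso_ideal I : is_ideal I -> is_ideal (fun y => I (g y)).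
Proof.
move=> [sI I0 ID IM]; have [ge g0 _ gD gM] := homg; split.
- by move=> x y /ge; exact: sI.
- exact: sI (sym g0) I0.
- by move=> x y Ix Iy; apply: sI (sym (gD x y)) _; exact: ID.
- by move=> r x Ix; apply: sI (sym (gM r x)) _; exact: IM.
Qed.

Lemma iso_proper I : is_ideal I -> Defs.proper I -> Defs.proper (fun y => I (g y)).
Proof. by move=> [sI _ _ _] pI; have [_ _ g1 _ _] := homg => /(sI _ _ g1). Qed.

Lemma iso_ssub_set I J : saturated I -> saturated J -> ssub_set I J ->
  ssub_set (fun y => I (g y)) (fun y => J (g y)).
Proof.
move=> sI sJ [IJ nJI]; split=> [y /IJ //|JI]; apply: nJI => x Jx.
by apply: (sI _ _ (gf x)); apply: JI; apply: sJ Jx; exact: sym.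
Qed.

End IsoBasic.

Section IsoMaximal.
Variables (A B : sring) (f : A -> B) (g : B -> A).
Hypothesis iso : sring_iso f g.

Let iso' := sring_iso_sym iso.
Let equivB : sring_equiv B. Proof. by case: iso. Qed.
Let symB (y z : B) : seqv y z -> seqv z y. Proof. by case: equivB => _ h _ _; exact: h. Qed.
Let fg y : seqv (f (g y)) y. Proof. by case: iso => _ _ _ _ []. Qed.

Lemma iso_maximal_ideal M : maximal_ideal M -> maximal_ideal (fun y => M (g y)).
Proof.
move=> [hM pM maxM]; split; [exact: (iso_ideal iso)|exact: (iso_proper iso)|].
move=> J hJ pJ MJ y Jy.
have sJ := ideal_saturated hJ; have sM := ideal_saturated hM.
apply: (maxM (fun x => J (f x))); [exact: (iso_ideal iso')|exact: (iso_proper iso')| |].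
  move=> x Mx; apply: MJ; move: Mx; rewrite -[X in X x -> _](iso_saturated_id iso sM) //.
by apply: sJ Jy; exact: symB.
Qed.

End IsoMaximal.

Section IsoStructure.
Variables (A B : sring) (f : A -> B) (g : B -> A).
Hypothesis iso : sring_iso f g.

Let iso' := sring_iso_sym iso.
Let equivA : sring_equiv A. Proof. by case: iso. Qed.
Let equivB : sring_equiv B. Proof. by case: iso. Qed.
Let homf : sring_hom f. Proof. by case: iso. Qed.
Let homg : sring_hom g. Proof. by case: iso. Qed.
Let symB (y z : B) : seqv y z -> seqv z y. Proof. by case: equivB => _ h _ _; exact: h. Qed.
Let transA (x y z : A) : seqv x y -> seqv y z -> seqv x z.
Proof. by case: equivA => _ _ h _; exact: h. Qed.
Let gf x : seqv (g (f x)) x. Proof. by case: iso => _ _ _ _ []. Qed.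
Let fg y : seqv (f (g y)) y. Proof. by case: iso => _ _ _ _ []. Qed.

Lemma iso_is_local M : is_local M -> is_local (fun y => M (g y)).
Proof.
move=> [maxM uniq]; split; first exact: (iso_maximal_ideal iso).
move=> P maxP y; have sP : saturated P by apply: ideal_saturated; case: maxP.
have /(_ (g y)) := uniq _ (iso_maximal_ideal iso' maxP).
by rewrite -[X in X y <-> _](iso_saturated_id iso' sP).
Qed.

Lemma iso_prime_ideal P : prime_ideal P -> prime_ideal (fun y => P (g y)).
Proof.
move=> [hP pP PM]; split; [exact: (iso_ideal iso)|exact: (iso_proper iso)|].
move=> x y; have [_ _ _ _ gM] := homg; have [sP _ _ _] := hP.
by move=> /(sP _ _ (gM x y)) /PM.
Qed.

Lemma iso_krull_dim_ge n : krull_dim_ge A n -> krull_dim_ge B n.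
Proof.
move=> [P [pP sP]]; exists (fun i y => P i (g y)); split=> i hi.
  by apply: iso_prime_ideal; exact: pP.
apply: (iso_ssub_set iso); last exact: sP.
  by apply: ideal_saturated; have [] := pP i (ltnW hi).
by apply: ideal_saturated; have [] := pP i.+1 hi.
Qed.

Lemma iso_ipow_sub I n x : saturated I -> ipow I n x -> ipow (fun y => I (g y)) n (f x).
Proof.
move=> sI; elim: n x => // n IH x; apply: span_hom => // z [a [b [Ia [Ib zE]]]].
have [fe _ _ _ fM] := homf; have [_ _ trans _] := equivB.
exists (f a), (f b); split; first exact: IH.
split; last by apply: (trans) (fe _ _ zE) _.
by move: Ib; rewrite -[X in X b -> _](iso_saturated_id iso sI).
Qed.

Lemma iso_finitely_generated J : saturated J ->
  finitely_generated (fun x => J (f x)) -> finitely_generated J.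
Proof.
move=> sJ [n [a aE]]; exists n, (fun i => f (a i)) => y.
have [fe _ _ _ _] := homf; have [ge _ _ _ _] := homg.
split=> [|h].
  rewrite -[X in X y -> _](iso_saturated_id iso' sJ) => /aE h.
  apply: (span_saturated equivB (fg y)); apply: span_hom h => // z [i [hi zE]].
  by exists i; split=> //; exact: fe.
rewrite -[J](iso_saturated_id iso' sJ); apply/aE; apply: span_hom h => // z [i [hi zE]].
by exists i; split=> //; apply: transA (gf _); exact: ge.
Qed.

Lemma iso_noetherian : noetherian A -> noetherian B.
Proof.
move=> noeth J hJ; apply: iso_finitely_generated; first exact: ideal_saturated.
by apply: noeth; exact: (iso_ideal iso').
Qed.

Lemma iso_chain_ge J l : chain_ge J l -> chain_ge (fun y => J (g y)) l.
Proof.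
move=> [I [hI sI]]; exists (fun i y => I i (g y)); split=> i hi.
  by have [? JI] := hI i hi; split=> [|y /JI //]; exact: (iso_ideal iso).
by apply: (iso_ssub_set iso); [| |exact: sI]; apply: ideal_saturated;
  [have [] := hI i (ltnW hi)|have [] := hI i.+1 hi].
Qed.

End IsoStructure.

Section IsoMultiplicity.
Variables (A B : sring) (f : A -> B) (g : B -> A).
Hypothesis iso : sring_iso f g.

Let iso' := sring_iso_sym iso.
Let equivA : sring_equiv A. Proof. by case: iso. Qed.
Let equivB : sring_equiv B. Proof. by case: iso. Qed.

Lemma iso_ipow I n : saturated I -> ipow (fun y => I (g y)) n = (fun y => ipow I n (g y)).
Proof.
move=> sI; have sIg : saturated (fun y => I (g y)).
  by move=> x y xy; apply: sI; case: iso => _ _ _ [ge _ _ _ _] _; exact: ge.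
apply/funext => y; apply/propext; split.
  by move=> /(iso_ipow_sub iso' sIg); rewrite (iso_saturated_id iso sI).
move=> /(iso_ipow_sub iso sI); apply: ipow_saturated => //.
by case: iso => _ _ _ _ [].
Qed.

Lemma iso_quot_length J l : saturated J -> quot_length J l -> quot_length (fun y => J (g y)) l.
Proof.
move=> sJ [cJ ncJ]; split; first exact: (iso_chain_ge iso).
by move=> /(iso_chain_ge iso'); rewrite (iso_saturated_id iso sJ).
Qed.

Lemma iso_multiplicity e : multiplicity A e -> multiplicity B e.
Proof.
move=> [N [d [P [locN [dim ndim] [k0 lenP] eE]]]].
have sN : saturated N by apply: ideal_saturated; case: locN => -[].
exists (fun y => N (g y)), d, P; split=> //; first exact: (iso_is_local iso).
  by split; [exact: (iso_krull_dim_ge iso)|move=> /(iso_krull_dim_ge iso')].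
exists k0 => k /lenP[l [len PE]]; exists l; split=> //.
by rewrite iso_ipow //; apply: iso_quot_length => //; exact: ipow_saturated.
Qed.

Lemma iso_noetherian_local_mult_le2 : noetherian_local_mult_le2 A -> noetherian_local_mult_le2 B.
Proof.
move=> [noeth [[N locN] [e [mul e2]]]]; split; first exact: (iso_noetherian iso).
split; first by exists (fun y => N (g y)); exact: (iso_is_local iso).
by exists e; split=> //; exact: iso_multiplicity.
Qed.

End IsoMultiplicity.

End Transfer.

(** * Characteristic properties of the [m]-adic completion *)

Section CompletionProperties.
Import GRing.Theory.
Local Open Scope ring_scope.

(** In order: [R] is dense in [C], [R/m^k] embeds into [C/m^k C], and [C] is separated and
    complete. *)
Definition is_completion (R C : comNzRingType) (iota : {rmorphism R -> C}) (m : R) :=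
  [/\ forall k c, exists r d, c = iota r + iota m ^+ k * d,
      forall k r, principal (iota m ^+ k) (iota r) -> principal (m ^+ k) r,
      forall c, (forall k, principal (iota m ^+ k) c) -> c = 0 &
      forall s : nat -> C, (forall k, principal (iota m ^+ k) (s k.+1 - s k)) ->
        exists c, forall k, principal (iota m ^+ k) (c - s k)].

Lemma ring_sring_equiv (C : comNzRingType) : sring_equiv (ring_sring C).
Proof. by split=> //= [x y z -> | x x' y y' -> ->]. Qed.

Variables (R : comNzRingType) (m : R).
Hypotheses (hm : nzd m) (nm : ~ principal m 1).

Lemma completion_equiv : sring_equiv (completion m).
Proof. split; [exact: ceqv_refl|exact: ceqv_sym|exact: ceqv_trans|exact: ceqv_cadd]. Qed.

Lemma compat_addn (f : cseq m) k j : principal (m ^+ k) (proj1_sig f (k + j)%N - proj1_sig f k).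
Proof.
have hI := ideal_principal (m ^+ k).
elim: j => [|j IH]; first by rewrite addn0 subrr; exact: idl0.
have [r e] := proj2_sig f (k + j)%N.
rewrite addnS -(subrKA (proj1_sig f (k + j)%N)); apply: (idlD hI) => //.
by rewrite e exprD -mulrA; exists (m ^+ j * r).
Qed.

Lemma cseq_divide (f : cseq m) k : principal (m ^+ k) (proj1_sig f k) ->
  exists d : cseq m, ceqv f (cmul (cconst m (m ^+ k)) d).
Proof.
(* The sequence is shifted by [k] before dividing: congruence modulo [m^(k+j)] becomes congruence
   modulo [m^j], as [m^k] cancels. *)
move=> fk; have : forall j, exists d, proj1_sig f (k + j)%N = m ^+ k * d.
  move=> j; have hI := ideal_principal (m ^+ k).
  by rewrite -[proj1_sig f _](subrK (proj1_sig f k)); apply: (idlD hI) => //; exact: compat_addn.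
move=> /choice[d dE].
have cd : compat m d.
  move=> j; have [r e] := proj2_sig f (k + j)%N; exists r.
  by apply: (nzdI (nzdX (k := k) hm)); rewrite mulrBr -!dE addnS e exprD mulrA.
exists (exist _ d cd) => j /=; rewrite -dE -opprB addnC.
by apply: (idlN (ideal_principal (m ^+ j))); exact: compat_addn.
Qed.

Lemma completion_ring_exists : exists (C : comNzRingType) (iota : {rmorphism R -> C}),
  is_completion iota m /\ exists f g, @sring_iso (completion m) (ring_sring C) f g.
Proof.
have [C [pi [pis piP [piD piN piM] pi0 pi1]]] := completion_ring nm.
pose io r := pi (cconst m r).
have ioB : {morph io : x y / x - y}.
  by move=> x y; rewrite /io -piN -piD; apply/piP/ceqv_pointwise.
have ioM : monoid_morphism io.
  by split=> // x y; rewrite /io -piM; apply/piP/ceqv_pointwise.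
pose iota : {rmorphism R -> C} := HB.pack io
  (GRing.isZmodMorphism.Build R C io ioB) (GRing.isMonoidMorphism.Build R C io ioM).
have ioX k : iota m ^+ k = pi (cconst m (m ^+ k)) by rewrite -rmorphXn.
(* Divisibility by the [k]-th power of [m] is visible on the [k]-th term alone; all four properties
   but the first follow by comparing terms, and the first by subtracting a constant sequence. *)
have key k f : principal (iota m ^+ k) (pi f) <-> principal (m ^+ k) (proj1_sig f k).
  split=> [[c]|/cseq_divide[d /piP e]]; last by exists (pi d); rewrite ioX -piM.
  have [h ->] := pis c; rewrite ioX -piM => /piP /(_ k)[r /= e].
  by exists (r + proj1_sig h k); rewrite mulrDr -e subrK.
exists C, iota; split; last first.
  have [g gE] := choice pis; exists pi, g; split.
  - exact: completion_equiv.
  - exact: ring_sring_equiv.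
  - by split=> //= x y /piP.
  - split=> /= [x y ->||||]; first exact: ceqv_refl.
    + by apply/piP; rewrite -gE pi0.
    + by apply/piP; rewrite -gE pi1.
    + by move=> x y; apply/piP; rewrite piD -!gE.
    + by move=> x y; apply/piP; rewrite piM -!gE.
  - by split=> /= [x|y]; [apply/piP|]; rewrite -gE.
split.
- move=> k c; have [f ->] := pis c; exists (proj1_sig f k).
  have [|d e] := (key k (cadd f (copp (cconst m (proj1_sig f k))))).2.
    by exists 0; rewrite /= subrr mulr0.
  by exists d; rewrite -e piD piN addrC subrK.
- by move=> k r /(key k (cconst m r)).
- move=> c; have [f ->] := pis c => h; rewrite -pi0; apply/piP => k /=.
  by rewrite subr0; apply/key.
(* The limit is the diagonal sequence, whose [k]-th term is the [k]-th term of a representative of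
   [s k]. *)
- move=> s hs; have [u uE] := choice (fun k => pis (s k)).
  have cE : compat m (fun k => proj1_sig (u k) k).
    move=> k; rewrite -(subrKA (proj1_sig (u k.+1) k)).
    apply: (idlD (ideal_principal (m ^+ k))); first exact: (proj2_sig (u k.+1)).
    have := hs k; rewrite !uE -piN -piD; by move=> /key.
  exists (pi (exist _ _ cE)) => k; rewrite uE -piN -piD; apply/key => /=.
  by exists 0; rewrite subrr mulr0.
Qed.

End CompletionProperties.

(** * From R to its completion *)

Section Ascent.
Variables (R C : comNzRingType) (iota : {rmorphism R -> C}) (m : R) (M : R -> Prop).
Import GRing.Theory.
Local Open Scope ring_scope.
Hypotheses (hC : is_completion iota m) (hM : local_at M) (Mm : M m) (hm : nzd m).

Let hMi : idl R M. Proof. by case: hM. Qed.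
Local Notation mu := (iota m).

Lemma completion_approx k c : exists r d, c = iota r + mu ^+ k * d.
Proof. by case: hC. Qed.
Lemma completion_principal k r : principal (mu ^+ k) (iota r) -> principal (m ^+ k) r.
Proof. by case: hC => _ h _ _; exact: h. Qed.
Lemma completion_sep c : (forall k, principal (mu ^+ k) c) -> c = 0.
Proof. by case: hC => _ _ h _; exact: h. Qed.

Lemma not_principal1 : ~ principal m 1.
Proof. by move=> [r e]; case: hM => _ + _; apply; rewrite e; exact: idlMr. Qed.

(** Approximate [c] by [r] modulo [mu^k]: then [m * r] is divisible by [m^(k+1)] in [R], where [m]
    cancels. Hence [c] is divisible by every power of [mu]. *)
Lemma completion_nzd : nzd mu.
Proof.
move=> c mc0; apply: completion_sep => k; have [r [d cE]] := completion_approx k c.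
have [|t mrE] := @completion_principal k.+1 (m * r).
  exists (- d); rewrite rmorphM.
  have -> : iota r = c - mu ^+ k * d by rewrite cE; ring.
  by rewrite mulrBr mc0 exprS; ring.
have -> : c = mu ^+ k * (iota t + d).
  have rE : r = m ^+ k * t by apply: (nzdI hm); rewrite mrE exprS; ring.
  by rewrite cE rE rmorphM rmorphXn mulrDr.
by exists (iota t + d).
Qed.

Lemma completion_unit d : exists c, (1 + mu * d) * c = 1.
Proof.
(* Partial sums of the geometric series for the inverse of [1 + mu * d]. *)
pose s := fix s k := if k is k'.+1 then s k' + (- (mu * d)) ^+ k' else 0.
have sE k : (1 + mu * d) * s k = 1 - (- (mu * d)) ^+ k.
  elim: k => [|k IH]; first by rewrite /= expr0; ring.
  by rewrite /= mulrDr IH exprS; ring.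
have powE k : (- (mu * d)) ^+ k = mu ^+ k * (- d) ^+ k by rewrite -mulrN exprMn.
have [_ _ _ /(_ s)[|c cE]] := hC.
  by move=> k; exists ((- d) ^+ k); rewrite -powE /=; ring.
exists c; apply/subr0_eq/completion_sep => k.
have -> : (1 + mu * d) * c - 1 = (1 + mu * d) * (c - s k) - mu ^+ k * (- d) ^+ k.
  by rewrite mulrBr sE powE; ring.
apply: (idlB (ideal_principal _)); first exact: (idlMl (ideal_principal _)).
by exists ((- d) ^+ k).
Qed.

(** This is the extended ideal [M C], because [R] is dense and [m] lies in [M]. *)
Definition completion_max : C -> Prop := fun c => exists r d, M r /\ c = iota r + mu * d.

Lemma completion_max_iota r : M r -> completion_max (iota r).
Proof. by move=> Mr; exists r, 0; split=> //; ring. Qed.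

Lemma completion_local : local_at completion_max.
Proof.
split.
- apply: idealP.
  + by exists 0, 0; split; [exact: idl0|rewrite rmorph0; ring].
  + move=> _ _ [r [d [Mr ->]]] [r' [d' [Mr' ->]]]; exists (r + r'), (d + d').
    by split; [exact: idlD|rewrite rmorphD; ring].
  + move=> c _ [r [d [Mr ->]]]; have [r' [d' ->]] := completion_approx 1 c.
    exists (r' * r), (d' * iota r + (iota r' + mu * d') * d).
    by split; [exact: idlMl|rewrite rmorphM expr1; ring].
- move=> [r [d [Mr e]]]; case: hM => _ M1 _; apply: M1.
  have [|t tE] := @completion_principal 1 (1 - r).
    by exists d; rewrite rmorphB rmorph1 e; ring.
  rewrite -(subrK r 1) tE expr1; apply: idlD => //; exact: idlMr.
- move=> c nc; have [r [d cE]] := completion_approx 1 c; rewrite expr1 in cE.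
  have [|r' rr'] := local_unit hM (x := r).
    by move=> Mr; apply: nc; exists r, d.
  have [u uE] := completion_unit (d * iota r'); exists (iota r' * u).
  have -> : c * (iota r' * u) = (iota (r * r') + mu * (d * iota r')) * u.
    by rewrite cE rmorphM; ring.
  by rewrite rr' rmorph1.
Qed.

Section Pair.
Variables (y x : R).
Hypothesis hp : quadratic_pair M y x.
Let NE z : M z <-> span2 y x z. Proof. by case: hp => _ ->. Qed.
Let My : M y. Proof. by apply/NE; exact: span2l. Qed.
Let Mx : M x. Proof. by apply/NE; exact: span2r. Qed.

Lemma completion_quadratic_pair : quadratic_pair completion_max (iota y) (iota x).
Proof.
have hI := ideal_span2 (iota y) (iota x).
have iotaM r : M r -> span2 (iota y) (iota x) (iota r).
  by move=> /NE[a [b ->]]; exists (iota a), (iota b); rewrite rmorphD !rmorphM.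
have [hmax _ _] := completion_local.
split.
(* [y] divides [m^2], whose image is a nonzerodivisor. *)
- have [t [_ mmE]] := quadratic_mul hM hp Mm Mm.
  apply: (@nzdMl _ _ (iota t)); rewrite -rmorphM -mmE rmorphM -expr2; apply: nzdX.
  exact: completion_nzd.
- move=> c; split; last by apply: span2_min => //; exact: completion_max_iota.
  move=> [r [d [Mr ->]]]; apply: (idlD hI); first exact: iotaM.
  by apply: (idlMr hI); exact: iotaM.
- have [_ _ [r [s xx]]] := hp; exists (iota r), (iota s).
  by rewrite -rmorphM xx !(rmorphM, rmorphD).
Qed.

Lemma telescope_principal (s : nat -> C) (z : C) :
  (forall j, principal (z ^+ j) (s j.+1 - s j)) ->
  forall j i, principal (z ^+ j) (s (j + i)%N - s j).
Proof.
move=> hs j; have hI := ideal_principal (z ^+ j).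
elim=> [|i IH]; first by rewrite addn0 subrr; exact: idl0.
rewrite addnS -(subrKA (s (j + i)%N)); apply: (idlD hI) => //.
have [r ->] := hs (j + i)%N; rewrite exprD -mulrA; by exists (z ^+ i * r).
Qed.

Hypothesis pow : exists k, principal m (y ^+ k).

Lemma quadratic_noetherian_local_mult_le2 : noetherian_local_mult_le2 (ring_sring C).
Proof.
have hL := completion_local; have hP := completion_quadratic_pair.
(* A power of [y] is divisible by [m], and [m^2] by [y], so the two adic topologies agree. The
   exponent is made positive for the index comparison [j <= k0.+1 * (2 * j)]. *)
have [k0 [t0 k0E]] : exists k, principal m (y ^+ k.+1).
  by have [k [t e]] := pow; exists k, (t * y); rewrite exprSr e mulrA.
have ym k c : principal (iota y ^+ (k0.+1 * k)) c -> principal (mu ^+ k) c.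
  move=> [r ->]; rewrite exprM -[iota y ^+ _]rmorphXn k0E rmorphM exprMn -mulrA.
  by exists (iota t0 ^+ k * r).
have [t1 [_ mmE]] := quadratic_mul hM hp Mm Mm.
have my k c : principal (mu ^+ (2 * k)) c -> principal (iota y ^+ k) c.
  move=> [r ->]; rewrite exprM expr2 -rmorphM mmE rmorphM exprMn -mulrA.
  by exists (iota t1 ^+ k * r).
have sep c : (forall j, principal (iota y ^+ j) c) -> c = 0.
  by move=> h; apply: completion_sep => k; apply: ym.
have compl (s : nat -> C) : (forall j, principal (iota y ^+ j) (s j.+1 - s j)) ->
    exists c, forall j, principal (iota y ^+ j) (c - s j).
  move=> /telescope_principal hs.
  (* The subsequence of indices [k0.+1 * k] is Cauchy for [mu]; closeness to its limit modulo
     [mu^(2j)] gives closeness modulo [y^j]. *)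
  have [_ _ _ /(_ (fun k => s (k0.+1 * k)%N))[|c cE]] := hC.
    by move=> k; apply: ym; rewrite mulnS addnC; exact: hs.
  exists c => j; rewrite -(subrKA (s (k0.+1 * (2 * j))%N)).
  apply: (idlD (ideal_principal _)); first by apply: my; exact: cE.
  have /subnKC <- : (j <= k0.+1 * (2 * j))%N by rewrite mulnA leq_pmull.
  exact: hs.
split; first exact: (complete_noetherian hL hP).
split; first by exists completion_max; exact: local_at_is_local.
by apply: (quadratic_multiplicity hL hP); exact: (complete_dim_lt2 hL hP).
Qed.

End Pair.
End Ascent.

(** * From the completion to R *)

Section Nilpotency.
Variable S : comNzRingType.
Import GRing.Theory.
Local Open Scope ring_scope.

(** A pigeonhole on factors: each factor contributes either to the power of [X] or to that of [a],
    so the induction on [i + j] lowers one of the two. *)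
Lemma ipow_adjoin (X : S -> Prop) a i j z : idl S X -> (adjoin X a ^^ (i + j)) z ->
  isum (X ^^ i) (principal (a ^+ j)) z.
Proof.
move=> hX; move En : (i + j)%N => n; elim: n i j En z => [|n IH] i j En z.
  move: En => /eqP; rewrite addn_eq0 => /andP[/eqP -> /eqP ->] _.
  by exists 0, z; split=> //; [exists z; rewrite expr0 mul1r|ring].
case: i En => [|i] En; first by move=> _; exists z, 0; split=> //; [exists 0; ring|ring].
case: j En => [|j] En.
  move=> _; exists 0, z; split; [|by exists z; rewrite expr0 mul1r|ring].
  exact: idl0 (ideal_ipow X i.+1).
have hI := ideal_isum (ideal_ipow X i.+1) (ideal_principal (a ^+ j.+1)).
apply: ipowS_min z => // u _ hu [x [r [Xx ->]]]; rewrite mulrDr; apply: (idlD hI).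
  have [|v [w [Xv [t ->] ->]]] := IH i j.+1 _ u hu; first by case: En; rewrite addnS.
  exists (v * x), (a ^+ j.+1 * (t * x)); split; [exact: ipowSM|by exists (t * x)|ring].
have [|v [w [Xv [t ->] ->]]] := IH i.+1 j _ u hu.
  by move: En; rewrite addnS => -[].
exists (v * (r * a)), (a ^+ j.+1 * (t * r)); split; last by rewrite exprSr; ring.
  by apply: (idlMr (ideal_ipow X i.+1)).
by exists (t * r).
Qed.

Lemma ipow_gens_sub (K : S -> Prop) g n : idl S K -> (forall i, (i < n)%N -> exists k, K (g i ^+ k)) ->
  exists s, forall z, (gens (eq 0) g n ^^ s) z -> K z.
Proof.
move=> hK; elim: n => [|n IH] gK.
  exists 1%N => z /(ipow1 (ideal_zero S)) <-; exact: idl0.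
have [s sK] : exists s, forall z, (gens (eq 0) g n ^^ s) z -> K z.
  by apply: IH => i hi; apply: gK; exact: ltnW.
have [k Kk] := gK n (ltnSn n); exists (s + k)%N => z.
move=> /(ipow_adjoin (ideal_gens g n (ideal_zero S)))[u [v [/sK Ku [t ->] ->]]].
by apply: idlD => //; exact: idlMr.
Qed.

End Nilpotency.

(** * Linear bounds for the length of the quotients by powers of [N] *)

Section LengthBounds.
Variables (S : comNzRingType) (N : S -> Prop) (mu : S).
Import GRing.Theory.
Local Open Scope ring_scope.
Notation chain := (@chain_ge (ring_sring S)).
Hypotheses (hN : local_at N) (Nmu : N mu).

Lemma chain_ge_gens (X : S -> Prop) g n t : idl S X ->
  (forall i c, (i < n)%N -> N c -> X (c * g i)) -> chain X (n + t)%N -> chain (gens X g n) t.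
Proof.
move=> hX; elim: n t => [|n IH] t NX; first by rewrite add0n.
rewrite addSnnS => /IH h; apply: (chain_ge_adjoin hN); first exact: ideal_gens.
  by move=> c Nc; apply: sub_gens; apply: NX.
by apply: h => i c hi; apply: NX; exact: ltnW.
Qed.

(** The point is uniformity: [n] counts generators of [N^j] and bounds the length of
    [c N^j / c N^(j+1)] for every [c] at once. *)
Lemma chain_ge_scale_ipow j : @finitely_generated (ring_sring S) (N ^^ j) ->
  exists n, forall c t, chain (scale c (N ^^ j.+1)) (n + t)%N -> chain (scale c (N ^^ j)) t.
Proof.
move=> /fgP[n [g gE]]; exists n => c t.
have hX := ideal_scale c (ideal_ipow N j.+1).
have hg i : (i < n)%N -> (N ^^ j) (g i).
  by move=> hi; apply/gE; apply: mem_gens => //; exact: ideal_zero.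
move=> /(@chain_ge_gens _ (fun i => c * g i) n t hX) h; apply: chain_ge_sub (h _).
  move=> _ [u [/gE hu ->]]; move: u hu; apply: gens_min.
  - exact/ideal_colon/ideal_gens.
  - by move=> u <-; rewrite mulr0; apply: idl0; exact: ideal_gens.
  - by move=> i hi; apply: (@mem_gens _ _ (fun i => c * g i)) => //.
move=> i d hi Nd; exists (g i * d); split; last by ring.
by apply: ipowSM => //; exact: hg.
Qed.

(** Each quotient [mu^k S / mu^(k+1) S] has length at most a fixed [L], since [mu^k N^s] lies in
    [mu^(k+1) S]; and [mu^k S] lies in [N^k]. *)
Lemma chain_ge_ipow_linear s : @noetherian (ring_sring S) ->
  (forall z, (N ^^ s) z -> principal mu z) ->
  exists L, forall k l, chain (N ^^ k) l -> (l <= k * L)%N.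
Proof.
move=> noeth Ns.
have [L hL] : exists L, forall c t,
    chain (scale c (N ^^ s)) (L + t)%N -> chain (scale c (fun=> True)) t.
  elim: s {Ns} => [|j [L hL]]; first by exists 0%N.
  have [n hn] := chain_ge_scale_ipow (noeth _ (ideal_ipow N j)).
  by exists (n + L)%N => c t; rewrite -addnA => /hn /hL.
have step k t : chain (scale (mu ^+ k) (fun=> True)) (k * L + t)%N -> chain (scale 1 (fun=> True)) t.
  elim: k t => [|k IH] t; first by rewrite mul0n add0n expr0.
  rewrite mulSn -addnA => h; apply: IH; apply: hL; apply: chain_ge_sub h.
  move=> _ [u [/Ns[v ->] ->]]; exists v; split=> //; rewrite exprSr; ring.
exists L => k l h; rewrite leqNgt; apply/negP => lt.
have : chain (scale 1 (fun=> True)) (l - k * L)%N.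
  apply: (step k); rewrite subnKC; last exact: ltnW.
  apply: chain_ge_sub h => _ [u [_ ->]]; apply: (idlMr (ideal_ipow N k)); exact: ipowX.
have -> : scale 1 (fun=> True) = (fun=> True) :> (S -> Prop).
  by apply: eq_ideal => z; split=> // _; exists z; split=> //; ring.
by move=> /(quot_length_chain_le (quot_length_True S)); rewrite leqn0 subn_eq0 leqNgt lt.
Qed.

Lemma chain_ge_ipow_lower :
  (forall n a b, (2 <= n)%N -> (N ^^ n) a -> (N ^^ n) b ->
     ~ forall z, (N ^^ n) z -> isum (span2 a b) (N ^^ n.+1) z) ->
  forall k, chain (N ^^ k.+2) (3 * k)%N.
Proof.
move=> big; have hI k := ideal_ipow N k.
have hJ a b k := ideal_isum (ideal_span2 a b) (hI k).
elim=> [|k IH]; first by exists (fun=> N ^^ 2); split=> // i _; split=> //; exact: hI.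
have bigE a b : (N ^^ k.+2) a -> (N ^^ k.+2) b -> exists2 c, (N ^^ k.+2) c &
    ~ isum (span2 a b) (N ^^ k.+3) c.
  by move=> Na Nb; have /existsNP[c /not_implyP[]] := big k.+2 a b isT Na Nb; exists c.
pose J a b := isum (span2 a b) (N ^^ k.+3).
have J0 a b z : (N ^^ k.+3) z -> J a b z.
  by move=> Nz; exists 0, z; split=> //; [exact: idl0 (ideal_span2 _ _)|rewrite add0r].
have Jmin a b K : idl S K -> K a -> K b -> (forall z, (N ^^ k.+3) z -> K z) ->
    forall z, J a b z -> K z.
  move=> hK Ka Kb NK _ [u [v [abu /NK Kv ->]]].
  by apply: (idlD hK) => //; exact: span2_min abu.
have Jl a b : J a b a by exists a, 0; split; [exact: span2l|exact: idl0|rewrite addr0].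
have Jr a b : J a b b by exists b, 0; split; [exact: span2r|exact: idl0|rewrite addr0].
have N0 : (N ^^ k.+2) 0 by exact: idl0.
(* Three strict steps from [N^(k+3)] to [N^(k+2)]: adjoin [a], then [b], then everything. Repeating
   an argument of [J] covers the cases of fewer than two generators. *)
have [a Na nJa] := bigE 0 0 N0 N0; have [b Nb nJb] := bigE a a Na Na.
have [c Nc nJc] := bigE a b Na Nb.
have sub : forall z, (N ^^ k.+3) z -> (N ^^ k.+2) z by move=> z; apply: ipow_le.
rewrite mulnS; apply: (@chain_ge_cons _ _ (J a a)) => //; first exact: J0.
  by move=> h; apply: nJa; apply: J0; apply: h; exact: Jl.
apply: (@chain_ge_cons _ _ (J a b)) => //; first exact: hJ.
- by apply: Jmin; [exact: hJ|exact: Jl|exact: Jl|exact: J0].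
- by move=> h; apply: nJb; apply: h; exact: Jr.
apply: chain_ge_cons IH; first exact: hJ.
- exact: Jmin.
- by move=> /(_ c Nc).
Qed.

End LengthBounds.

(** * Growth of polynomials at large integers *)

Section Growth.
Import GRing.Theory Num.Theory Order.Theory.
Local Open Scope ring_scope.

Lemma poly_eventually_ge (p : {poly rat}) : (1 < size p)%N -> 0 < lead_coef p ->
  forall B, exists k0, forall k, (k0 <= k)%N -> B <= p.[k%:R].
Proof.
elim/poly_ind: p => [|q c IH]; first by rewrite size_poly0.
have [->|q0] := eqVneq q 0.
  by rewrite mul0r add0r size_polyC; case: (c == 0).
have lcE : lead_coef (q * 'X + c%:P) = lead_coef q.
  rewrite lead_coefDl ?lead_coefMX // size_mulX // size_polyC.
  by rewrite (leq_ltn_trans (leq_b1 _)) // ltnS size_poly_gt0.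
rewrite lcE => _ lq B.
(* The quotient [q] is either a positive constant or, by induction, eventually at least 1;
   multiplying by [k] exceeds any bound. *)
have [a a0 [k1 hk1]] : exists2 a : rat, 0 < a & exists k1, forall k, (k1 <= k)%N -> a <= q.[k%:R].
  have [q1|q1] := leqP (size q) 1; last first.
    by exists 1 => //; apply: IH.
  exists (lead_coef q) => //; exists 0%N => k _.
  by rewrite {2}[q]size1_polyC // hornerC lead_coefE; move: q1 q0;
    rewrite -size_poly_eq0; case: (size q) => [|[|]].
pose k2 := Num.bound (`|B - c| / a).
exists (maxn k1 k2) => k; rewrite geq_max => /andP[k1k k2k].
rewrite hornerD hornerM hornerX hornerC -lerBlDr.
have : `|B - c| / a <= k%:R.
  apply: le_trans (ltW (archi_boundP _)) _; first by rewrite divr_ge0 // ltW.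
  by rewrite ler_nat.
rewrite ler_pdivrMr // mulrC => h.
apply: le_trans (ler_norm _) _; apply: le_trans h _.
by apply: ler_wpM2r; [exact: ler0n|exact: hk1].
Qed.

(** The degree of [P] is not given. Degree two or more violates one of the linear bounds, according
    to the sign of the leading coefficient; otherwise the slope is at most 2, against the lower
    slope 3. *)
Lemma poly_linear_bounds (P : {poly rat}) d (L : rat) k0 : d`!%:R * lead_coef P <= 2 ->
  (forall k, (k0 <= k)%N -> 3 * k%:R - 6 <= P.[k%:R] /\ P.[k%:R] <= L * k%:R) -> False.
Proof.
move=> lcP bounds.
have [small|big] := leqP (size P) 2.
  have PE k : P.[k%:R] = P`_1 * k%:R + P`_0.
    rewrite (horner_coef_wide _ small) big_ord_recl big_ord1 /= expr0 expr1; ring.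
  (* A positive coefficient of degree one is the leading one, and [d!] is at least 1. *)
  have P1 : P`_1 <= 2.
    have [P10|P10] := leP P`_1 0; first exact: le_trans P10 _.
    have sP : size P = 2%N.
      apply/eqP; rewrite eqn_leq small ltnNge; apply/negP => h.
      by move: P10; rewrite nth_default // ltxx.
    move: lcP; rewrite lead_coefE sP /= => h; apply: le_trans h.
    by apply: ler_peMl; [exact: ltW|rewrite ler1n fact_gt0].
  (* Any [k] above the constant term plus 6 contradicts [3k - 6 <= 2k + P(0)]. *)
  pose k := maxn k0 (Num.bound `|P`_0 + 6|).
  have [lo _] := bounds k (leq_maxl _ _).
  have kb : P`_0 + 6 < k%:R.
    apply: le_lt_trans (ler_norm _) _; apply: lt_le_trans (archi_boundP (normr_ge0 _)) _.
    by rewrite ler_nat leq_maxr.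
  have : P`_1 * k%:R <= 2 * k%:R by apply: ler_wpM2r.
  by move: lo kb; rewrite PE; lra.
have sX (a b : rat) : (size (a *: 'X + b%:P)%R <= 2)%N.
  apply: leq_trans (size_polyD _ _) _; rewrite geq_max size_polyC.
  rewrite (leq_trans (size_scale_leq _ _)) ?size_polyX //=.
  by rewrite (leq_trans (leq_b1 _)).
have P0 : lead_coef P != 0 by rewrite lead_coef_eq0 -size_poly_gt0 (leq_trans _ big).
have [neg|pos] := ltP (lead_coef P) 0.
  (* The lower bound on [P] keeps [Q] at most 1, while [Q] tends to infinity. *)
  pose Q := - P + ((3 : rat) *: 'X + (- 5 : rat)%:P).
  have sQ : (size ((3 : rat) *: 'X + (- 5 : rat)%:P)%R < size (- P)%R)%N.
    by rewrite size_polyN; exact: leq_ltn_trans (sX _ _) big.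
  have [||k1 hk1] := @poly_eventually_ge Q _ _ 2.
  - by rewrite size_polyDl // size_polyN ltnW.
  - by rewrite lead_coefDl // lead_coefN oppr_gt0.
  have := hk1 (maxn k0 k1) (leq_maxr _ _); have [+ _] := bounds (maxn k0 k1) (leq_maxl _ _).
  by rewrite /Q !(hornerD, hornerN, hornerZ, hornerX, hornerC); lra.
(* The upper bound on [P] keeps [Q] at most 0, while [Q] tends to infinity. *)
pose Q := P + ((- L) *: 'X + (0 : rat)%:P).
have sQ : (size ((- L) *: 'X + (0 : rat)%:P)%R < size P)%N.
  exact: leq_ltn_trans (sX _ _) big.
have [||k1 hk1] := @poly_eventually_ge Q _ _ 1.
- by rewrite size_polyDl // ltnW.
- by rewrite lead_coefDl // lt_neqAle eq_sym P0.
have := hk1 (maxn k0 k1) (leq_maxr _ _); have [_ +] := bounds (maxn k0 k1) (leq_maxl _ _).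
by rewrite /Q !(hornerD, hornerN, hornerZ, hornerX, hornerC); lra.
Qed.

End Growth.

(** * Contraction of powers of the maximal ideal from the completion *)

Section Descent.
Variables (R C : comNzRingType) (iota : {rmorphism R -> C}) (m : R) (M : R -> Prop).
Import GRing.Theory.
Local Open Scope ring_scope.
Hypotheses (hC : is_completion iota m) (hM : local_at M) (Mm : M m).

Let hMi : idl R M. Proof. by case: hM. Qed.
Local Notation mu := (iota m).
Local Notation N := (completion_max iota m M).
Let hN : local_at N. Proof. exact: completion_local. Qed.

(** For [m^k] in [K] this is the extended ideal [K C], and [extension_comap] shows that it contracts
    back to [K]. *)
Definition extension (K : R -> Prop) k : C -> Prop :=
  fun c => exists r d, K r /\ c = iota r + mu ^+ k * d.

Lemma ideal_extension K k : idl R K -> idl C (extension K k).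
Proof.
move=> hK; apply: idealP.
- by exists 0, 0; split; [exact: idl0|rewrite rmorph0; ring].
- move=> _ _ [r [d [Kr ->]]] [r' [d' [Kr' ->]]]; exists (r + r'), (d + d').
  by split; [exact: idlD|rewrite rmorphD; ring].
- move=> c _ [r [d [Kr ->]]]; have [t [e ->]] := completion_approx hC k c.
  exists (t * r), (e * iota r + (iota t + mu ^+ k * e) * d).
  by split; [exact: idlMl|rewrite rmorphM; ring].
Qed.

Lemma extension_iota (K : R -> Prop) k r : K r -> extension K k (iota r).
Proof. by move=> Kr; exists r, 0; split=> //; ring. Qed.

Lemma extension_comap (K : R -> Prop) k r : idl R K -> K (m ^+ k) ->
  extension K k (iota r) -> K r.
Proof.
move=> hK Kmk [t [d [Kt rE]]].
have [|u uE] := completion_principal hC (k := k) (r := r - t).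
  by exists d; rewrite rmorphB rE; ring.
by rewrite -(subrK t r) uE; apply: (idlD hK) => //; exact: (idlMr hK).
Qed.

Lemma ipow_iota k r : (M ^^ k) r -> (N ^^ k) (iota r).
Proof.
elim: k r => // k IH; apply: ipowS_min.
  apply: idealP => [|a b|a b].
  - by rewrite rmorph0; exact: idl0 (ideal_ipow _ _).
  - by rewrite rmorphD; exact: (idlD (ideal_ipow _ _)).
  - by rewrite rmorphM; exact: (idlMl (ideal_ipow _ _)).
move=> a b /IH Na Mb; rewrite rmorphM; apply: ipowSM => //.
exact: completion_max_iota.
Qed.

Lemma ipow_extension k c : (N ^^ k) c -> extension (M ^^ k) k c.
Proof.
elim: k c => [|k IH]; first by move=> c _; exists 0, c; split=> //; rewrite rmorph0; ring.
have hE := ideal_extension k.+1 (ideal_ipow M k.+1).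
(* A general element of [N] reduces to this case: its part from [M] directly, its multiple of [mu]
   with [s = m]. *)
have main a s : (N ^^ k) a -> M s -> extension (M ^^ k.+1) k.+1 (a * iota s).
  move=> /IH[r [d [Mr ->]]] Ms; have [t [e ->]] := completion_approx hC 1 d.
  exists (r * s + m ^+ k * (s * t)), (iota s * e); split.
    apply: (idlD (ideal_ipow M k.+1)); first exact: ipowSM.
    by apply: ipowSM; [exact: ipowX|exact: idlMr].
  by rewrite rmorphD !rmorphM rmorphXn expr1 exprSr; ring.
apply: ipowS_min => // a _ Na [r [d [Mr ->]]].
have -> : a * (iota r + mu * d) = a * iota r + (a * mu) * d by ring.
by apply: (idlD hE); [exact: main|apply: (idlMr hE); exact: main].
Qed.

Lemma ipow_comap k r : (N ^^ k) (iota r) -> (M ^^ k) r.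
Proof.
by move=> /ipow_extension; apply: extension_comap; [exact: ideal_ipow|exact: ipowX].
Qed.

Hypothesis noeth : @noetherian (ring_sring C).

(** Generators of [N^k] are approximated in [R] modulo [mu^k]; supplied to Nakayama, this replaces a
    Noetherian hypothesis on [R]. *)
Lemma ipow_finitely_generated k : @finitely_generated (ring_sring R) (M ^^ k).
Proof.
have hI := ideal_ipow M k.
have /fgP[n [c cE]] := noeth (ideal_ipow N k).
have /choice[r hr] : forall i, exists r, (i < n)%N ->
    (M ^^ k) r /\ exists d, c i = iota r + mu ^+ k * d.
  move=> i; have [hi|_] := boolP (i < n)%N; last by exists 0.
  have /ipow_extension[r [d [Mr e]]] : (N ^^ k) (c i).
    by apply/cE; apply: mem_gens => //; exact: ideal_zero.
  by exists r => _; split=> //; exists d.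
(* The extra generator [m^k] absorbs the approximation errors and makes the contraction apply. *)
pose g i := if i == n then m ^+ k else r i.
have hG := ideal_gens g n.+1 (ideal_zero R).
have gn : gens (eq 0) g n.+1 (m ^+ k).
  by have := @mem_gens _ (eq 0) g n.+1 n (ideal_zero R) (ltnSn n); rewrite /g eqxx.
apply/fgP; exists n.+1, g => z; split; last first.
  apply: gens_min => // [x <-|i]; first exact: idl0.
  rewrite ltnS leq_eqVlt /g; case: eqP => [_ _|_ /= hi]; first exact: ipowX.
  by have [] := hr i hi.
move=> Mz; apply: (extension_comap hG gn).
move/ipow_iota/cE: Mz; apply: gens_min; first exact: ideal_extension.
  by move=> x <-; rewrite -(rmorph0 iota); apply: extension_iota; exact: idl0.
move=> i hi; have [_ [d ->]] := hr i hi; exists (r i), d; split=> //.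
have := @mem_gens _ (eq 0) g n.+1 i (ideal_zero R) (ltnW hi).
by rewrite /g (ltn_eqF hi).
Qed.

Lemma two_generated_descent n a b : (N ^^ n) a -> (N ^^ n) b ->
  (forall z, (N ^^ n) z -> isum (span2 a b) (N ^^ n.+1) z) -> @two_generated (ring_sring R) (M ^^ n).
Proof.
move=> Na Nb gen; have hI := ideal_ipow M.
(* Precision [n.+1] puts the errors into [N^(n+1)], which Nakayama ignores. *)
have lift c : (N ^^ n) c -> exists r d, (M ^^ n) r /\ c = iota r + mu ^+ n.+1 * d.
  move=> Nc; have [r [d cE]] := completion_approx hC n.+1 c; exists r, d; split=> //.
  apply: ipow_comap; have -> : iota r = c - mu ^+ n.+1 * d by rewrite cE; ring.
  apply: (idlB (ideal_ipow N n)) => //; apply: (idlMr (ideal_ipow N n)).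
  by apply: (ipow_le (leqnSn n)); apply: ipowX; exact: completion_max_iota.
have [ra [da [Mra aE]]] := lift a Na; have [rb [db [Mrb bE]]] := lift b Nb.
pose K := isum (span2 ra rb) (M ^^ n.+1).
have hK : idl R K by apply: ideal_isum; [exact: ideal_span2|exact: hI].
have hE := ideal_extension n.+1 hK.
have MK z : (M ^^ n.+1) z -> K z.
  by move=> Mz; exists 0, z; split=> //; [exact: idl0 (ideal_span2 _ _)|rewrite add0r].
have spanK z : span2 ra rb z -> K z.
  by move=> hz; exists z, 0; split=> //; [exact: idl0|rewrite addr0].
have MsubK z : (M ^^ n) z -> K z.
  move=> /ipow_iota/gen[u [v [abu /ipow_extension[r [d [Mr vE]]] zE]]].
  apply: (extension_comap (k := n.+1) hK); first by apply/MK/ipowX.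
  rewrite zE; apply: (idlD hE); last by exists r, d; split=> //; exact: MK.
  apply: span2_min abu => //.
  - by exists ra, da; split=> //; apply: spanK; exact: span2l.
  - by exists rb, db; split=> //; apply: spanK; exact: span2r.
apply/two_generatedP; exists ra, rb => z; split; last exact: span2_min.
by apply: (nakayama_ipow hM (ideal_span2 ra rb) (ipow_finitely_generated n)).
Qed.

Lemma ipow_sub_principal : (forall x, M x -> exists k, principal m (x ^+ k)) ->
  exists s, forall z, (N ^^ s) z -> principal mu z.
Proof.
move=> pow; have [hNi _ _] := hN.
have /fgP[n [g gE]] := noeth hNi; have hmu := ideal_principal mu.
have [i hi|s hs] := @ipow_gens_sub C (principal mu) g n hmu.
  have [r [d [Mr ->]]] : N (g i) by apply/gE; apply: mem_gens => //; exact: ideal_zero.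
  have [k [t rk]] := pow r Mr; exists k.
  (* The [k]-th powers of [iota r + mu * d] and [iota r] differ by a multiple of [mu], and
     [iota r ^+ k] is such a multiple. *)
  rewrite -(subrK (iota r ^+ k) ((_ + _) ^+ k)); apply: (idlD hmu); last first.
    by exists (iota t); rewrite -rmorphXn rk rmorphM.
  by rewrite subrXX addrAC subrr add0r -mulrA; eexists.
by exists s; rewrite (eq_ideal gE).
Qed.

Lemma multiplicity_two_generated_ipow :
  (forall x, M x -> exists k, principal m (x ^+ k)) ->
  (exists e, @multiplicity (ring_sring C) e /\ (e <= 2)%R) ->
  exists n, (2 <= n)%N /\ @two_generated (ring_sring R) (M ^^ n).
Proof.
move=> /ipow_sub_principal[s hs] [e [[N' [d [P [locN' _ [k0 lenP] ->]]]] e2]].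
have NE : N' = N.
  by apply: eq_ideal => z; case: (local_at_is_local hN) => maxN _; case: locN' => _ /(_ _ maxN) /(_ z) [].
rewrite {locN'}NE in lenP.
apply: contrapT => none.
have Nmu : N mu by exact: completion_max_iota.
have [L hL] := chain_ge_ipow_linear hN Nmu noeth hs.
have low : forall k, @chain_ge (ring_sring C) (N ^^ k.+2) (3 * k)%N.
  apply: chain_ge_ipow_lower => n a b n2 Na Nb gen; apply: none; exists n; split=> //.
  exact: two_generated_descent gen.
(* The threshold 2 makes the truncated [k - 2] a true difference, so that [3 * (k - 2)] reads
   [3k - 6]. *)
apply: (@poly_linear_bounds P d L%:R (maxn k0 2) e2) => k; rewrite geq_max => /andP[k0k k2].
have [l [len ->]] := lenP k k0k; split; last first.
  by rewrite -natrM Num.Theory.ler_nat mulnC; apply: hL; case: len.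
have := low (k - 2)%N; rewrite -addn2 subnK // => /(quot_length_chain_le len).
rewrite -(Num.Theory.ler_nat rat) natrM natrB // mulrBr => h.
by apply: Order.POrderTheory.le_trans h; lra.
Qed.

End Descent.

(** * The equivalences *)

Section Main.
Variables (R : comNzRingType) (M : R -> Prop) (m : R).
Import GRing.Theory.
Local Open Scope ring_scope.
Hypotheses (hM : local_at M) (dim1 : @krull_dim (ring_sring R) 1) (Mm : M m) (hm : nzd m).

Lemma two_generated_regular n (I : R -> Prop) : (2 <= n)%N ->
  @two_generated (ring_sring R) (M ^^ n) -> idl R I -> @regular_ideal (ring_sring R) I ->
  @two_generated (ring_sring R) I.
Proof.
move=> n2 two hI [z [Iz hz]].
have [y [x hp]] := two_generated_ipow_quadratic_pair hM Mm hm n2 two.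
have My : M y by case: hp => _ NE _; apply/NE; exact: span2l.
have [k [t yk]] := power_in_principal hM dim1 hz My.
by apply: (two_generated_of_power hM hp (k := k)) => //; rewrite yk; exact: idlMr.
Qed.

Lemma regular_two_generated :
  (forall I : R -> Prop, idl R I -> @regular_ideal (ring_sring R) I ->
     @two_generated (ring_sring R) I) ->
  exists n, (2 <= n)%N /\ @two_generated (ring_sring R) (M ^^ n).
Proof.
move=> reg; exists 2%N; split=> //; apply: reg; first exact: ideal_ipow.
by exists (m ^+ 2); split; [exact: ipowX|exact: nzdX].
Qed.

Lemma two_generated_ipow_completion :
  (exists n, (2 <= n)%N /\ @two_generated (ring_sring R) (M ^^ n)) <->
  noetherian_local_mult_le2 (completion m).
Proof.
have [C [iota [hC [f [g iso]]]]] := completion_ring_exists hm (not_principal1 hM Mm).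
split=> [[n [n2 two]]|].
  apply: (iso_noetherian_local_mult_le2 (sring_iso_sym iso)).
  have [y [x hp]] := two_generated_ipow_quadratic_pair hM Mm hm n2 two.
  apply: (quadratic_noetherian_local_mult_le2 hC hM Mm hm hp).
  by apply: (power_in_principal hM dim1 hm); case: hp => _ NE _; apply/NE; exact: span2l.
move=> /(iso_noetherian_local_mult_le2 iso)[noeth [_ mult]].
apply: (multiplicity_two_generated_ipow hC hM Mm noeth _ mult) => x.
exact: power_in_principal.
Qed.

End Main.

Unset Implicit Arguments.

Theorem theorem5p4 (R : comNzRingType) (M : R -> Prop) (m : R) :
  is_local (A := ring_sring R) M ->
  krull_dim (ring_sring R) 1 ->
  regular_ideal (A := ring_sring R) M ->
  M m ->
  nonzerodivisor (A := ring_sring R) m ->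
  ((exists n : nat, (2 <= n)%N /\ two_generated (ipow (A := ring_sring R) M n))
     <-> noetherian_local_mult_le2 (completion m)) /\
  (noetherian_local_mult_le2 (completion m)
     <-> (forall I : R -> Prop, is_ideal (A := ring_sring R) I ->
            regular_ideal (A := ring_sring R) I ->
            two_generated (A := ring_sring R) I)).
Proof.
move=> /is_local_local_at hM dim1 _ Mm hm.
have eq12 := two_generated_ipow_completion hM dim1 Mm hm.
split=> //; rewrite -eq12; split=> [[n [n2 two]] I|].
  exact: (two_generated_regular hM dim1 Mm hm n2 two).
exact: (regular_two_generated Mm hm).
Qed.
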